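(* Let $\mathfrak{h}$ be a separable Hilbert space and let $\mathfrak{X}=\mathscr{T}_s(\mathfrak{h})$ be the real Banach space of self-adjoint trace class operators on $\mathfrak{h}$ with the trace norm. Let $(\mathcal{U}(t))_{t\ge0}$ be a substochastic $C_0$-semigroup on $\mathfrak{X}$ with generator $\mathcal{A}$, $\mathcal{B}:\mathscr{D}(\mathcal{A})\to\mathfrak{X}$ a positive linear operator with $\mathrm{Trace}[(\mathcal{A}+\mathcal{B})\varrho]\le0$ for all $\varrho\in\mathscr{D}(\mathcal{A})\cap\mathfrak{X}_+$, let $(\mathcal{V}(t))_{t\ge0}$ be the associated minimal semigroup with generator $\mathcal{G}$, and let $\mathcal{H}=\{\varrho\in\mathfrak{X}_+:\langle\mathbf{\Xi}_\lambda,\varrho\rangle=0\text{ for any }\lambda>0\}$. For $\lambda>0$ let $\beta_\lambda$ be the positive bounded self-adjoint operator on $\mathfrak{h}$ such that $\langle\mathbf{\Xi}_\lambda,\varrho\rangle=\mathrm{Trace}[\beta_\lambda\varrho]$ for all $\varrho\in\mathfrak{X}_+$. Then the null space of $\beta_\lambda$ is independent of $\lambda$, and $$\mathcal{H}=\{\varrho\in\mathfrak{X}_+:\varrho=\mathbf{P}\varrho=\varrho\mathbf{P}\}=\{\varrho\in\mathfrak{X}_+:\mathbf{Q}\varrho=\varrho\mathbf{Q}=0\},$$ where $\mathbf{P}$ is the orthogonal projection of $\mathfrak{h}$ onto $\mathrm{Null}(\beta_\lambda)$ and $\mathbf{Q}=\mathbf{Id}_{\mathfrak{h}}-\mathbf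{P}$.
   Context: $\mathfrak{X}=\mathscr{T}_s(\mathfrak{h})$ is ordered by the cone $\mathfrak{X}_+$ of positive semidefinite operators, $\|\varrho\|=\mathrm{Trace}[|\varrho|]$, and $\langle\mathbf{\Psi},\varrho\rangle=\mathrm{Trace}[\varrho]$, so that $\langle\mathbf{\Psi},\varrho\rangle=\|\varrho\|$ on $\mathfrak{X}_+$. A linear operator on $\mathfrak{X}$ is positive if it maps positive elements of its domain into $\mathfrak{X}_+$. A $C_0$-semigroup $(T(t))_{t\ge0}$ on $\mathfrak{X}$ is substochastic if each $T(t)$ is positive and $\|T(t)u\|\le\|u\|$ for $u\in\mathfrak{X}_+$. Minimal semigroup: under the stated hypotheses there is a smallest (for the operator order, for each $t$) substochastic $C_0$-semigroup $(\mathcal{V}(t))_{t\ge0}$ whose generator $\mathcal{G}$ extends $(\mathcal{A}+\mathcal{B},\mathscr{D}(\mathcal{A}))$; it satisfies $(\lambda-\mathcal{G})^{-1}u=\lim_{n\to\infty}(\lambda-\mathcal{A})^{-1}\sum_{k=0}^n[\mathcal{B}(\lambda-\mathcal{A})^{-1}]^ku$ for all $\lambda>0$, $u\in\mathfrak{X}$. Functionals: $\mathfrak{a}_0(u)=-\langle\mathbf{\Psi},\mathcal{G}u\rangle$ for $u\in\mathscr{D}(\mathcal{G})$; $\mathfrak{a}$ is its restriction to $\mathscr{D}(\mathcal{A})$; and $\overline{\mathfrak{a}}:\mathscr{D}(\mathcal{G})\to\mathbb{R}$ is the linear functional defined by $\overline{\mathfrak{a}}((\lambda-\mathcal{G})^{-1}u)=\sum_{n=0}^\infty\mathfrak{a}\big((\lambda-\mathcal{A})^{-1}[\mathcal{B}(\lambda-\mathcal{A})^{-1}]^nu\big)$,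 $u\in\mathfrak{X}$, where the series converges and the resulting functional does not depend on $\lambda>0$. For $\lambda>0$, $\mathbf{\Xi}_\lambda\in\mathfrak{X}^\star$ is the (positive) functional $\langle\mathbf{\Xi}_\lambda,u\rangle=\mathfrak{a}_0((\lambda-\mathcal{G})^{-1}u)-\overline{\mathfrak{a}}((\lambda-\mathcal{G})^{-1}u)$, $u\in\mathfrak{X}$; the operator $\beta_\lambda$ representing it through the trace duality exists. *)

(* Defs.v *)
From HB Require Import structures.
From mathcomp Require Import all_boot all_order all_algebra.
From mathcomp Require Import complex.
From mathcomp Require Import all_classical all_reals all_analysis.

Set Implicit Arguments.
Unset Strict Implicit.
Unset Printing Implicit Defensive.

Import Order.TTheory GRing.Theory Num.Theory numFieldNormedType.Exports.
Local Open Scope classical_set_scope.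
Local Open Scope ring_scope.

(* MathComp-Analysis.  A complex Hilbert space is a complete normed R[i]-module
   h with a positive definite hermitian form, linear in its first argument,
   such that form x x = `|x| ^+ 2 (predicate [hilbert_form]).  Operators on h
   are functions h -> h; the real vector space X of self-adjoint trace class
   operators is the subset [Ts] of these, with the norm [tnorm].  Operators on
   X act on h -> h, and only their values on Ts (or on their domain, a subset
   of Ts) matter.  A choice by [get] returns an arbitrary value when nothing
   satisfies the specification. *)

Definition separable (T : topologicalType) :=
  exists D : set T, countable D /\ dense D.

Section TraceClass.
Context {R : realType} {h : completeNormedModType R[i]}.
Variable form : {dot h for Num.conj}.
Implicit Types (S T u v : h -> h) (E N : set h).

Definition hilbert_form := forall x : h, form x x = `|x| ^+ 2.

Definition orthonormal_basis E :=
  (forall x y, E x -> E y -> form x y = (x == y)%:R) /\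
  (forall z, (forall e, E e -> form z e = 0) -> z = 0).

Definition onb : set h := get [set E | orthonormal_basis E].

Definition bounded_op T := linear T /\ continuous T.

Definition selfadjoint T := forall x y, form (T x) y = form x (T y).

Definition positive_op T := forall x, 0 <= form (T x) x.

Definition adjoint T : h -> h :=
  get [set S : h -> h | forall x y, form (T x) y = form x (S y)].

Definition abs_op T : h -> h :=
  get [set S : h -> h |
        [/\ bounded_op S, positive_op S & S \o S = adjoint T \o T]].

Definition diag T (e : h) : R[i] := form (T e) e.

(* Trace of |T|, possibly +oo; the diagonal entries of |T| are real. *)
Definition trace_abs T : \bar R :=
  (\esum_(e in onb) (complex.Re (diag (abs_op T) e))%:E)%E.

Definition trace_class T := bounded_op T /\ (trace_abs T < +oo)%E.

Definition tnorm T : R := fine (trace_abs T).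

(* Sum of an absolutely summable real family. *)
Definition sum_over E (f : h -> R) : R :=
  fine (\esum_(e in E) (EFin \o f)^\+ e)%E -
  fine (\esum_(e in E) (EFin \o f)^\- e)%E.

Definition trace T : R[i] :=
  (sum_over onb (fun e => complex.Re (diag T e)) +i*
   sum_over onb (fun e => complex.Im (diag T e)))%C.

Definition Ts : set (h -> h) := [set T | selfadjoint T /\ trace_class T].

Definition Tspos : set (h -> h) := [set T | Ts T /\ positive_op T].

(* The trace of a self-adjoint operator is real. *)
Definition Psi T : R := complex.Re (trace T).

Definition null_space T : set h := [set x | T x = 0].

Definition orth_proj N (x : h) : h :=
  get [set p | N p /\ forall y, N y -> form (x - p) y = 0].

End TraceClass.

Section Semigroups.
Context {R : realType} {h : completeNormedModType R[i]}.
Variable form : {dot h for Num.conj}.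

Local Notation op := (h -> h).
Local Notation X := (Ts form).
Local Notation Xpos := (Tspos form).

Implicit Types (u v w : op) (D : set op) (A B : op -> op) (U V W : R -> op -> op).

Definition rscale (r : R) u : op := r%:C%C *: u.

Definition linear_on D A :=
  forall (r : R) u v, D u -> D v -> A (rscale r u + v) = rscale r (A u) + A v.

Definition linear_functional_on D (f : op -> R) :=
  forall (r : R) u v, D u -> D v -> f (rscale r u + v) = r * f u + f v.

Definition positive_on D A := forall u, D u -> Xpos u -> Xpos (A u).

Record C0_semigroup U : Prop := {
  C0_maps : forall t u, 0 <= t -> X u -> X (U t u) ;
  C0_linear : forall t, 0 <= t -> linear_on X (U t) ;
  C0_bounded : forall t, 0 <= t ->
    exists M : R, forall u, X u -> tnorm form (U t u) <= M * tnorm form u ;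
  C0_id : forall u, X u -> U 0 u = u ;
  C0_add : forall s t u, 0 <= s -> 0 <= t -> X u -> U (s + t) u = U s (U t u) ;
  C0_continuous : forall u, X u ->
    tnorm form (U t u - u) @[t --> (0 : R)^'+] --> (0 : R) }.

Definition substochastic U :=
  [/\ C0_semigroup U,
      forall t, 0 <= t -> positive_on X (U t)
    & forall t u, 0 <= t -> Xpos u -> tnorm form (U t u) <= tnorm form u].

Definition gen_graph U u v :=
  [/\ X u, X v &
      tnorm form (rscale t^-1 (U t u - u) - v) @[t --> (0 : R)^'+] --> (0 : R)].

Definition gen_dom U : set op := [set u | exists v, gen_graph U u v].

Definition gen U u : op := get [set v | gen_graph U u v].

(* (lambda - A)^-1 u, for A with domain D. *)
Definition resolvent D A (lambda : R) u : op :=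
  get [set v : op | D v /\ rscale lambda v - A v = u].

Definition admissible_perturbation U B :=
  [/\ forall u, gen_dom U u -> X (B u),
      linear_on (gen_dom U) B,
      positive_on (gen_dom U) B
    & forall u, gen_dom U u -> Xpos u -> Psi form (gen U u + B u) <= 0].

Definition generator_extends U B V :=
  forall u, gen_dom U u -> gen_dom V u /\ gen V u = gen U u + B u.

Definition minimal_semigroup U B V :=
  [/\ substochastic V, generator_extends U B V &
      forall W, substochastic W -> generator_extends U B W ->
        forall t u, 0 <= t -> Xpos u -> Xpos (W t u - V t u)].

(* The functional a is the restriction of a0 to gen_dom U. *)
Definition a0 V u : R := - Psi form (gen V u).

Definition is_abar U B V (abar : op -> R) :=
  linear_functional_on (gen_dom V) abar /\
  forall (lambda : R) u, 0 < lambda -> X u ->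
    let RA := resolvent (gen_dom U) (gen U) lambda in
    series (fun n => a0 V (RA (iter n (B \o RA) u))) @ \oo -->
      abar (resolvent (gen_dom V) (gen V) lambda u).

Definition Xi V (abar : op -> R) (lambda : R) u : R :=
  let RGu := resolvent (gen_dom V) (gen V) lambda u in a0 V RGu - abar RGu.

Definition Hset V (abar : op -> R) : set op :=
  [set rho | Xpos rho /\ forall lambda : R, 0 < lambda -> Xi V abar lambda rho = 0].

(* beta represents Xi_lambda through the trace duality. *)
Definition represents_Xi V (abar : op -> R) (lambda : R) (beta : op) :=
  [/\ bounded_op beta, selfadjoint form beta, positive_op form beta &
      forall rho, Xpos rho ->
        (Xi V abar lambda rho)%:C%C = trace form (beta \o rho)].

End Semigroups.

(* Main.v *)
(* Since beta_l >= 0 represents Xi_l, for rho = s o s in the positive cone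
   Xi_l(rho) = Tr(s beta_l s) vanishes iff beta_l rho = 0, i.e. iff the range of
   rho lies in Null(beta_l); the description of H by P and Q follows, and rank
   one operators turn the independence of Null(beta_l) into that of
   {Xi_l = 0} in the cone.  For the latter, write Xi_l = F o (l - G)^-1 with
   F = a0 - abar linear on D(G).  The resolvent identity shows that Xi_l(u)
   decreases in l; if Xi_m(u) = 0 then it yields Xi_m((m - G)^-n u) = 0 for all
   n, and expanding (l - G)^-1 in powers of (m - G)^-1 gives Xi_l(u) = 0 for
   l < m.  The resolvent of G exists because V is a contraction semigroup on
   the Banach space X: with T(t) = e^(-lt) V(t), the vectors
   d (1 - T(d))^-1 u, d = 2^-n, form a Cauchy sequence, whose limit is
   (l - G)^-1 u.  The trace norm is handled through the Jordan decomposition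
   T = T+ - T-, which minimizes Tr a + Tr b among T = a - b with a, b >= 0. *)
From HB Require Import structures.
Require Import Defs.
From mathcomp Require Import all_boot all_order all_algebra.
From mathcomp Require Import complex.
From mathcomp Require Import all_classical all_reals all_analysis.
From mathcomp Require Import ring lra.
Import Order.TTheory GRing.Theory Num.Theory numFieldNormedType.Exports.
Local Open Scope classical_set_scope.
Local Open Scope ring_scope.

Set Implicit Arguments.
Unset Strict Implicit.
Unset Printing Implicit Defensive.

(** * The real inner product *)

Section InnerProduct.
Context {R : realType} {h : completeNormedModType R[i]}.
Variable form : {dot h for Num.conj}.
Hypothesis form_hilbert : hilbert_form form.
Implicit Types (x y z : h) (r : R) (S T : h -> h).

(** The basis, the absolute value, the generator and the resolvent are choices made by [get], so
    nothing can be said of them before existence, and where needed uniqueness, is established: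
    Zorn's lemma serves for the basis, a majorized iteration for square roots, Riemann sums of the
    Laplace transform for the resolvent. The trace is a sum over one fixed basis, so cyclicity does
    not come for free; trace inequalities are reduced to Hilbert-Schmidt norms of square roots,
    which agree for an operator and its adjoint because Parseval turns both into one double sum.
    Positivity and boundedness of Xi_l on the cone are read off its representation as a trace
    against beta_l. Monotonicity carries a zero of Xi only upwards in l; the downward direction is
    the delicate one and rests on the norm bound 1/m for (m - G)^-1. *)

Definition inner x y : R := complex.Re (form x y).
Local Notation ip := inner.
Definition hnorm x : R := Num.sqrt (ip x x).
Local Notation nm := hnorm.
Definition rs (r : R) (x : h) : h := (r%:C)%C *: x.
Definition iC (x : h) : h := ('i)%C *: x.

Lemma formC x y : form y x = (form x y)^*%C.
Proof. by rewrite hermC expr0 mul1r. Qed.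

Lemma ipC x y : ip x y = ip y x.
Proof. by rewrite /inner formC; case: (form y x). Qed.

Lemma formDl x y z : form (x + y) z = form x z + form y z.
Proof. exact: linearDl. Qed.

Lemma formNl x z : form (- x) z = - form x z.
Proof. exact: linearNl. Qed.

Lemma formZl a x z : form (a *: x) z = a * form x z.
Proof. exact: linearZl_LR. Qed.

Lemma ipDl x y z : ip (x + y) z = ip x z + ip y z.
Proof. by rewrite /inner formDl; case: (form x z); case: (form y z). Qed.

Lemma ipNl x z : ip (- x) z = - ip x z.
Proof. by rewrite /inner formNl; case: (form x z) => a b /=; simpc. Qed.

Lemma ipZl r x z : ip (rs r x) z = r * ip x z.
Proof. by rewrite /inner formZl; case: (form x z) => a b /=; simpc. Qed.

Lemma ipBl x y z : ip (x - y) z = ip x z - ip y z.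
Proof. by rewrite ipDl ipNl. Qed.

Lemma ip0l z : ip 0 z = 0.
Proof. by rewrite -(subrr 0) ipBl subrr. Qed.

Lemma ipDr x y z : ip z (x + y) = ip z x + ip z y.
Proof. by rewrite !(ipC z) ipDl. Qed.

Lemma ipNr x z : ip z (- x) = - ip z x.
Proof. by rewrite !(ipC z) ipNl. Qed.

Lemma ipBr x y z : ip z (x - y) = ip z x - ip z y.
Proof. by rewrite !(ipC z) ipBl. Qed.

Lemma ipZr r x z : ip z (rs r x) = r * ip z x.
Proof. by rewrite !(ipC z) ipZl. Qed.

Lemma ip0r z : ip z 0 = 0.
Proof. by rewrite ipC ip0l. Qed.

Definition ipE := (ipDl, ipBl, ipNl, ipZl, ipDr, ipBr, ipNr, ipZr, ip0l, ip0r).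

Lemma iCD x y : iC (x + y) = iC x + iC y.
Proof. exact: scalerDr. Qed.

Lemma iCN x : iC (- x) = - iC x.
Proof. exact: scalerN. Qed.

Lemma iCiC x : iC (iC x) = - x.
Proof. by rewrite /iC scalerA -expr2 sqr_i scaleN1r. Qed.

Lemma ip_iCr x y : ip x (iC y) = complex.Im (form x y).
Proof.
rewrite /inner /iC linearZr_LR /=.
by case: (form x y) => a b /=; simpc.
Qed.

Lemma ip_iCl x y : ip (iC x) y = - ip x (iC y).
Proof.
rewrite ip_iCr /inner /iC formZl /=.
by case: (form x y) => a b /=; simpc.
Qed.

(** The imaginary part is itself a real inner product, against [iC y], so statements on the complex
    form reduce to real ones. *)
Lemma formE x y : form x y = (ip x y +i* ip x (iC y))%C.
Proof. by rewrite ip_iCr /inner; case: (form x y). Qed.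

Lemma rsD r s x : rs (r + s) x = rs r x + rs s x.
Proof. by rewrite /rs rmorphD scalerDl. Qed.
Lemma rsDr r x y : rs r (x + y) = rs r x + rs r y.
Proof. exact: scalerDr. Qed.
Lemma rsA r s x : rs r (rs s x) = rs (r * s) x.
Proof. by rewrite /rs scalerA rmorphM. Qed.
Lemma rs1 x : rs 1 x = x.
Proof. exact: scale1r. Qed.
Lemma rs0 x : rs 0 x = 0.
Proof. exact: scale0r. Qed.
Lemma rsN r x : rs (- r) x = - rs r x.
Proof. by rewrite /rs rmorphN scaleNr. Qed.
Lemma rsNr r x : rs r (- x) = - rs r x.
Proof. exact: scalerN. Qed.

Lemma form_norm x : (ip x x)%:C%C = `|x| ^+ 2.
Proof.
rewrite -form_hilbert formE; congr (_ +i* _)%C.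
by have := ip_iCl x x; rewrite ipC => /eqP; rewrite -subr_eq0 opprK -mulr2n
   mulrn_eq0 /= => /eqP.
Qed.

Lemma ip_ge0 x : 0 <= ip x x.
Proof. by rewrite -lecR form_norm exprn_ge0. Qed.

Lemma nm_ge0 x : 0 <= nm x. Proof. exact: sqrtr_ge0. Qed.

Lemma nm_sqr x : nm x ^+ 2 = ip x x.
Proof. by rewrite sqr_sqrtr ?ip_ge0. Qed.

Lemma nmE x : `|x| = (nm x)%:C%C.
Proof.
apply/eqP; rewrite -(@eqrXn2 _ 2) ?normr_ge0 ?ler0c ?nm_ge0 //.
by rewrite -form_norm -nm_sqr rmorphXn.
Qed.

Lemma nmD x y : nm (x + y) <= nm x + nm y.
Proof. by rewrite -lecR rmorphD /= -!nmE ler_normD. Qed.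

Lemma nmN x : nm (- x) = nm x.
Proof. by rewrite /hnorm ipNl ipNr opprK. Qed.

Lemma nmB x y : nm (x - y) <= nm x + nm y.
Proof. by rewrite -(nmN y) nmD. Qed.

Lemma nmC x y : nm (x - y) = nm (y - x).
Proof. by rewrite -nmN opprB. Qed.

Lemma nm0 : nm 0 = 0.
Proof. by rewrite /hnorm ip0l sqrtr0. Qed.

Lemma nm_eq0 x : nm x = 0 -> x = 0.
Proof. by move=> x0; apply/normr0_eq0; rewrite nmE x0. Qed.

Lemma ip_eq0 x : ip x x = 0 -> x = 0.
Proof. by move=> x0; apply: nm_eq0; rewrite /hnorm x0 sqrtr0. Qed.

Lemma nmZ r x : nm (rs r x) = `|r| * nm x.
Proof. by rewrite /hnorm ipZl ipZr mulrA -expr2 sqrtrM ?sqr_ge0 // sqrtr_sqr. Qed.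

Lemma nm_iC x : nm (iC x) = nm x.
Proof. by rewrite /hnorm ip_iCl iCiC ipNr opprK. Qed.

Lemma nm_le x (r : R) : 0 <= r -> ip x x <= r ^+ 2 -> nm x <= r.
Proof. by move=> r0 xr; rewrite -ler_sqr ?nnegrE ?nm_ge0 // nm_sqr. Qed.

Lemma ip_ext x y : (forall z, ip x z = ip y z) -> x = y.
Proof.
move=> xy; apply/eqP; rewrite -subr_eq0; apply/eqP/ip_eq0.
by rewrite ipBl xy subrr.
Qed.

Lemma sqr_le_mul_of_quadratic_ge0 (a b c : R) :
  0 <= c -> (forall t, 0 <= a + 2 * t * b + t ^+ 2 * c) -> b ^+ 2 <= a * c.
Proof.
move=> cge0 q; have [c0|c0] := eqVneq c 0.
  have [->|b0] := eqVneq b 0; first by rewrite c0 expr0n mulr0.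
  (* With [c = 0] the expression is affine in [t]; this [t] makes it equal to [-1]. *)
  have := q (- (a + 1) / (2 * b)).
  rewrite c0 (_ : a + _ + _ = -1); first by rewrite ler0N1.
  by field.
have cp : 0 < c by rewrite lt_neqAle eq_sym c0.
have := q (- b / c).
rewrite (_ : a + _ + _ = (a * c - b ^+ 2) / c); last by field.
by rewrite pmulr_lge0 ?invr_gt0 // subr_ge0.
Qed.

(** Discriminant of the quadratic form of [T] along [x + t y]. Besides the usual inequality ([T] the
    identity) it is applied to positive operators, where it controls [T x] by [ip (T x) x]. *)
Lemma psd_cauchy_schwarz T :
  (forall x y, T (x + y) = T x + T y) -> (forall r x, T (rs r x) = rs r (T x)) ->
  (forall x y, ip (T x) y = ip x (T y)) -> (forall x, 0 <= ip (T x) x) ->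
  forall x y, ip (T x) y ^+ 2 <= ip (T x) x * ip (T y) y.
Proof.
move=> TD TZ Ts T0 x y; apply: sqr_le_mul_of_quadratic_ge0 => [|t]; first exact: T0.
have := T0 (x + rs t y); rewrite TD TZ !ipE (Ts y x) (ipC y).
by congr (_ <= _); ring.
Qed.

Lemma cauchy_schwarz x y : `|ip x y| <= nm x * nm y.
Proof.
rewrite -ler_sqr ?nnegrE ?mulr_ge0 ?nm_ge0 // exprMn !nm_sqr.
rewrite real_normK ?num_real //.
by apply: (@psd_cauchy_schwarz id) => // z; exact: ip_ge0.
Qed.

End InnerProduct.

(** * Limits and nearest points *)

Section HilbertLimits.
Context {R : realType} {h : completeNormedModType R[i]}.
Variable form : {dot h for Num.conj}.
Hypothesis form_hilbert : hilbert_form form.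
Implicit Types (x y z : h) (r : R) (S T : h -> h) (u v : nat -> h).

Local Notation ip := (inner form).
Local Notation nm := (hnorm form).

(** The norm of [h] takes values in [R[i]]; measuring distances with the real [hnorm] makes the
    lemmas on real sequences available. *)
Definition hcvg u x := (fun n => nm (u n - x)) @ \oo --> (0 : R).
Local Notation cvs := hcvg.

Lemma cvs_of_le u x (d : nat -> R) :
  (forall n, nm (u n - x) <= d n) -> d @ \oo --> (0 : R) -> cvs u x.
Proof.
move=> ud d0; apply: (@squeeze_cvgr _ _ _ _ (cst 0) d) => //; last exact: cvg_cst.
by apply: nearW => n; rewrite nm_ge0 ud.
Qed.

Lemma hilbert_complete u :
  (forall e : R, 0 < e -> exists N, forall m n, (N <= m)%N -> (N <= n)%N ->
     nm (u m - u n) < e) -> exists x, cvs u x.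
Proof.
move=> uc.
have cu : cvg (u @ \oo).
  apply/cauchy_cvgP/cauchy_ballP => e e0.
  (* A positive element of [R[i]] is real, hence determined by its real part. *)
  have re : 0 < complex.Re e by move: e0; rewrite ltcE => /andP[].
  have eE : e = (complex.Re e)%:C%C.
    by apply/eqP; rewrite eq_complex /= eqxx; move: e0; rewrite ltcE => /andP[].
  have [N uN] := uc _ re.
  near_simpl; exists ([set n | (N <= n)%N], [set n | (N <= n)%N]).
    by split; exists N.
  move=> [m n] /= [Nm Nn]; rewrite -ball_normE /= (nmE form_hilbert) eE ltcR.
  exact: uN.
have [x ux] := (cvg_ex (u @ \oo)).1 cu.
exists x; apply/cvgrPdist_le => e e0.
have e0' : 0 < e%:C%C :> R[i] by rewrite ltcR.
move/cvgrPdist_le : ux => /(_ _ e0').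
apply: filterS => n; rewrite (nmE form_hilbert) lecR sub0r normrN.
by rewrite ger0_norm ?nm_ge0 // nmC.
Qed.

Lemma hilbert_complete_le u (d : nat -> R) :
  (forall m n, (m <= n)%N -> nm (u n - u m) <= d m) -> d @ \oo --> (0 : R) ->
  exists x, cvs u x.
Proof.
move=> ud d0; apply: hilbert_complete => e e0.
have e2 : 0 < e / 2 by rewrite divr_gt0.
move/cvgrPdist_lt : d0 => /(_ _ e2) [N _ dN]; exists N => m n Nm Nn.
have dNe k : (N <= k)%N -> nm (u k - u N) < e / 2.
  move=> Nk; apply: le_lt_trans (ud _ _ Nk) _.
  apply: le_lt_trans (ler_norm _) _; rewrite -normrN -sub0r.
  exact: (dN N (leqnn N)).
have -> : u m - u n = (u m - u N) - (u n - u N) by rewrite opprB addrA subrK.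
apply: le_lt_trans (nmB form_hilbert _ _) _.
by rewrite [ltRHS](splitr e) ltrD ?dNe.
Qed.

Lemma cvs_ip u x y : cvs u x -> (fun n => ip (u n) y) @ \oo --> ip x y.
Proof.
move=> ux; apply/subr_cvg0.
have : (fun n => nm (u n - x) * nm y) @ \oo --> (0 : R).
  by rewrite -(mul0r (nm y)); apply: cvgM ux _; exact: cvg_cst.
move=> /cvgr0Pnorm_le b0; apply/cvgr0Pnorm_le => e /b0.
apply: filterS => n; apply: le_trans.
rewrite -ipBl; apply: le_trans (cauchy_schwarz form_hilbert _ _) _.
exact: ler_norm.
Qed.

Lemma cvs_nm u x : cvs u x -> (fun n => nm (u n)) @ \oo --> nm x.
Proof.
move=> ux; apply/subr_cvg0.
move: ux => /cvgr0Pnorm_le b0; apply/cvgr0Pnorm_le => e /b0.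
apply: filterS => n; apply: le_trans.
rewrite [leRHS]ger0_norm ?nm_ge0 // ler_norml lerBrDr.
have := nmD form_hilbert (u n - x) x; rewrite subrK.
have := nmD form_hilbert (x - u n) (u n); rewrite subrK (nmC form x).
by move=> h1 h2; apply/andP; split; lra.
Qed.

Lemma cvs_unique u x y : cvs u x -> cvs u y -> x = y.
Proof.
move=> ux uy; apply: (@ip_ext _ _ _ form_hilbert) => z.
have xz := cvg_lim (@Rhausdorff R) (cvs_ip (y := z) ux).
by rewrite -xz (cvg_lim (@Rhausdorff R) (cvs_ip (y := z) uy)).
Qed.

Lemma cvs_cst x : cvs (cst x) x.
Proof.
rewrite /cvs [X in X @ _ --> _](_ : _ = cst 0); first exact: cvg_cst.
by apply/funext => n /=; rewrite subrr nm0.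
Qed.

Lemma cvsD u v x y : cvs u x -> cvs v y -> cvs (fun n => u n + v n) (x + y).
Proof.
move=> ux vy; apply: (@cvs_of_le _ _ (fun n => nm (u n - x) + nm (v n - y))).
  by move=> n; rewrite opprD addrACA nmD.
by rewrite -(addr0 0); exact: cvgD.
Qed.

Lemma cvs_lipschitz (A : h -> h) (M : R) u x :
  (forall y z, nm (A y - A z) <= M * nm (y - z)) ->
  cvs u x -> cvs (A \o u) (A x).
Proof.
move=> AM ux; apply: (@cvs_of_le _ _ (fun n => M * nm (u n - x))).
  by move=> n; exact: AM.
by rewrite -(mulr0 M); apply: cvgM ux; exact: cvg_cst.
Qed.

Lemma cvs_rs r u x : cvs u x -> cvs (fun n => rs r (u n)) (rs r x).
Proof.
apply: (@cvs_lipschitz (rs r) `|r|) => y z.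
by rewrite -nmZ rsDr rsNr.
Qed.

Lemma cvs_iC u x : cvs u x -> cvs (fun n => iC (u n)) (iC x).
Proof.
apply: (@cvs_lipschitz iC 1) => y z.
by rewrite mul1r -iCN -iCD nm_iC.
Qed.

(** The nearest point is only asserted to be a limit of points of [N], so that the lemma serves both
    closed kernels and the set [approximable], not yet known to be closed. *)
Lemma projection_exists (N : set h) (x : h) :
  N 0 -> (forall y z, N y -> N z -> N (y + z)) ->
  (forall (a : R[i]) y, N y -> N (a *: y)) ->
  exists p, (exists2 u, (forall n, N (u n)) & cvs u p) /\
            forall y, N y -> form (x - p) y = 0.
Proof.
move=> N0 ND NZ.
pose D := [set ip (x - y) (x - y) | y in N].
have Dinf : has_inf D.
  split; first by exists (ip (x - 0) (x - 0)), 0.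
  by exists 0 => _ [y _ <-]; exact: ip_ge0.
pose d := inf D.
have dle y : N y -> d <= ip (x - y) (x - y) by move=> Ny; apply: ge_inf => //; [exact: Dinf.2|exists y].
have /choice[u uP] : forall n : nat, exists y, N y /\ ip (x - y) (x - y) <= d + n.+1%:R^-1.
  move=> n; have n0 : 0 < n.+1%:R^-1 :> R by rewrite invr_gt0.
  have [_ [y Ny <-] yd] := inf_adherent n0 Dinf.
  by exists y; split => //; exact: ltW.
have [uN ud] : (forall n, N (u n)) /\ (forall n, ip (x - u n) (x - u n) <= d + n.+1%:R^-1).
  by split => n; have [] := uP n.
have inv_le m n : (m <= n)%N -> n.+1%:R^-1 <= m.+1%:R^-1 :> R.
  by move=> mn; rewrite lef_pV2 ?posrE // ler_nat.
have [p up] : exists p, cvs u p.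
  (* Parallelogram law: the midpoint is at squared distance at least [d], so the squared gap is at
     most [2 / m.+1 + 2 / n.+1 <= 4 / m.+1]. *)
  apply: (@hilbert_complete_le _ (fun m => 2 * Num.sqrt m.+1%:R^-1)).
    move=> m n mn; apply: nm_le => //=.
    rewrite exprMn sqr_sqrtr ?invr_ge0 //.
    have Nmid : N (rs 2^-1 (u m + u n)) by apply: NZ; exact: ND.
    have := dle _ Nmid; have := ud m; have := ud n; have := inv_le _ _ mn.
    rewrite !ipE (ipC form (u n) x) (ipC form (u m) x) (ipC form (u n) (u m)).
    by move: (m.+1%:R^-1) (n.+1%:R^-1) => a b; lra.
  rewrite -(mulr0 2); apply: cvgM; first exact: cvg_cst.
  rewrite -[X in _ --> X](@sqrtr0 R).
  exact: (cvg_comp _ _ (@cvg_harmonic R) (@sqrt_continuous R 0)).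
have pd : ip (x - p) (x - p) <= d.
  have c1 : (fun n => ip (x - u n) (x - p)) @ \oo --> ip (x - p) (x - p).
    apply: cvs_ip; apply: (@cvs_lipschitz (fun y => x - y) 1 u p) => // y z.
    by rewrite opprB addrC addrA subrK nmC mul1r.
  have c2 : (fun n => nm (x - u n)) @ \oo --> nm (x - p).
    apply: cvs_nm; apply: (@cvs_lipschitz (fun y => x - y) 1 u p) => // y z.
    by rewrite opprB addrC addrA subrK nmC mul1r.
  have c3 : (fun n => nm (x - u n) ^+ 2) @ \oo --> ip (x - p) (x - p).
    by rewrite -nm_sqr // expr2; apply: cvgM.
  have c4 : (fun n => d + n.+1%:R^-1) @ \oo --> d.
    by rewrite -[X in _ --> X]addr0; apply: cvgD; [exact: cvg_cst|exact: cvg_harmonic].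
  apply: (ler_cvg_to c3 c4); apply: nearW => n.
  by rewrite nm_sqr //; exact: ud.
have orth y : N y -> ip (x - p) y = 0.
  move=> Ny.
  (* First variation: the competitor [u n - t y] does not beat the infimum [d], and this survives
     the limit in [n]. *)
  have var t : d <= ip (x - p) (x - p) + 2 * t * ip (x - p) y + t ^+ 2 * ip y y.
    have c : (fun n => ip (u n) y) @ \oo --> ip p y by exact: cvs_ip.
    have c2 : (fun n => nm (x - u n) ^+ 2) @ \oo --> ip (x - p) (x - p).
      rewrite -nm_sqr // expr2; apply: cvgM; apply: cvs_nm;
      apply: (@cvs_lipschitz (fun y => x - y) 1 u p) => // w z;
      by rewrite opprB addrC addrA subrK nmC mul1r.
    have c3 : (fun n => nm (x - u n) ^+ 2 + 2 * t * (ip x y - ip (u n) y) + t ^+ 2 * ip y y) @ \oo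
       --> ip (x - p) (x - p) + 2 * t * ip (x - p) y + t ^+ 2 * ip y y.
      apply: cvgD; last exact: cvg_cst.
      apply: cvgD => //; apply: cvgM; first exact: cvg_cst.
      by rewrite ipBl; apply: cvgB => //; exact: cvg_cst.
    apply: (ler_cvg_to (cvg_cst d) c3); apply: nearW => n.
    have := dle (u n + (- t)%:C%C *: y) (ND _ _ (uN n) (NZ _ _ Ny)).
    rewrite nm_sqr // -/(rs (- t) y) !ipE (ipC form (u n) x) (ipC form y x) (ipC form y (u n)).
    move=> dn; apply: le_trans dn _.
    by rewrite le_eqVlt; apply/orP; left; apply/eqP; ring.
  apply/eqP; rewrite -sqrf_eq0 eq_le sqr_ge0 andbT.
  rewrite -(mul0r (ip y y)).
  apply: sqr_le_mul_of_quadratic_ge0 => [|t]; first exact: ip_ge0.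
  by have := var t; have := pd; lra.
exists p; split; first by exists u.
(* [N] is stable under [iC], so vanishing real parts give a vanishing form. *)
move=> y Ny; rewrite formE orth // orth //.
exact: NZ.
Qed.

End HilbertLimits.

(** * Orthonormal bases *)

Lemma esum_le_seqP (R : realType) (T : choiceType) (E : set T) (f : T -> R) (M : R) :
  (forall s, uniq s -> (forall e, e \in s -> E e) -> \sum_(e <- s) f e <= M) ->
  (\esum_(e in E) (f e)%:E <= M%:E)%E.
Proof.
move=> fM; apply: ge_ereal_sup => _ [F [/finite_seqP[s0 F0] FE] <-].
have F1 : F = [set` undup s0] by rewrite F0; apply/seteqP; split=> e /=; rewrite mem_undup.
rewrite F1 -fsbig_seq ?undup_uniq // sumEFin lee_fin fM ?undup_uniq //.
by move=> e es; apply: FE; rewrite F1.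
Qed.

Lemma esum_ge_seq (R : realType) (T : choiceType) (E : set T) (f : T -> R) s :
  uniq s -> (forall e, e \in s -> E e) ->
  ((\sum_(e <- s) f e)%:E <= \esum_(e in E) (f e)%:E)%E.
Proof.
move=> us sE; apply: esum_ge; exists [set` s].
  by split; [by apply/finite_seqP; exists s|exact: sE].
by rewrite -fsbig_seq // sumEFin.
Qed.

Lemma ler_sum_subseq (R : numDomainType) (T : eqType) (f : T -> R) (s t : seq T) :
  uniq s -> uniq t -> {subset s <= t} -> (forall e, 0 <= f e) ->
  \sum_(e <- s) f e <= \sum_(e <- t) f e.
Proof.
move=> us ut st f0; rewrite [leRHS](bigID (mem s)) /=.
have -> : \sum_(e <- t | mem s e) f e = \sum_(e <- s) f e.
  rewrite -big_filter; apply: perm_big; apply: uniq_perm => //.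
    exact: filter_uniq.
  move=> e; rewrite mem_filter /=; case es : (e \in s) => //=.
  exact: st.
by rewrite lerDl sumr_ge0.
Qed.

Section OrthonormalBases.
Context {R : realType} {h : completeNormedModType R[i]}.
Variable form : {dot h for Num.conj}.
Hypothesis form_hilbert : hilbert_form form.
Implicit Types (x y z : h) (r : R) (E : set h) (s t : seq h).

Local Notation ip := (inner form).
Local Notation nm := (hnorm form).

(** Zorn's lemma gives an orthonormal set maximal for inclusion; a nonzero vector orthogonal to it
    could be normalized and adjoined. *)
Lemma onbP : orthonormal_basis form (onb form).
Proof.
apply: (@getPex _ [set E | orthonormal_basis form E]) => /=.
pose ON E := forall x y, E x -> E y -> form x y = (x == y)%:R.
have [|E [EON Emax]] := @Zorn_bigcup _ ON.
  move=> F FON Ftot x y [X FX Xx] [Y FY Yy].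
  have [XY|YX] := Ftot _ _ FX FY; first exact: (FON _ FY x y (XY _ Xx) Yy).
  exact: (FON _ FX x y Xx (YX _ Yy)).
exists E; split=> // z zE; apply/eqP; apply: contrapT => /negP z0.
have nz0 : nm z != 0 by apply: contra_not_neq (elimN eqP z0); exact: nm_eq0.
pose e := rs (nm z)^-1 z.
have eE y : E y -> form e y = 0.
  by move=> Ey; rewrite /e /rs formZl zE // mulr0.
have ee : form e e = 1.
  rewrite form_hilbert (nmE form_hilbert) nmZ ger0_norm ?invr_ge0 ?nm_ge0 // mulVf //.
  by rewrite expr1n.
apply: (Emax (E `|` [set e])).
  split; first by move=> y; left.
  move=> /(_ e (or_intror erefl)) Ee.
  by have := eE e Ee; rewrite ee => /eqP; rewrite oner_eq0.
have e_neq y : E y -> (e == y) = false.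
  move=> Ey; apply/eqP => ey; have := eE y Ey.
  by rewrite -ey ee => /eqP; rewrite oner_eq0.
move=> x y [Ex|->] [Ey|->].
- exact: EON.
- by rewrite formC eE // conjc0 eq_sym e_neq.
- by rewrite eE // e_neq.
- by rewrite eqxx ee.
Qed.

(** The squared modulus, kept in [R] so that it can be summed by [esum]. *)
Definition csq (a : R[i]) : R := complex.Re a ^+ 2 + complex.Im a ^+ 2.

Lemma csq_ge0 a : 0 <= csq a.
Proof. by rewrite addr_ge0 // sqr_ge0. Qed.

Lemma csqJ a : csq a^*%C = csq a.
Proof. by case: a => a b; rewrite /csq /= sqrrN. Qed.

Lemma csqE a : (csq a)%:C%C = a * a^*%C.
Proof. 
case: a => a b; apply/eqP; rewrite eq_complex /csq /=.
by apply/andP; split; apply/eqP; ring. Qed.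

Lemma nm_scale (c : R[i]) x : nm (c *: x) = Num.sqrt (csq c) * nm x.
Proof.
by apply: complexI; rewrite rmorphM /= -!(nmE form_hilbert) normrZ normc_def.
Qed.

Section Basis.
Variable E : set h.
Hypothesis Eonb : orthonormal_basis form E.

Definition proj_seq s x : h := \sum_(e <- s) form x e *: e.

Lemma form_proj_seq s x e : uniq s -> (forall e, e \in s -> E e) -> E e ->
  form (proj_seq s x) e = if e \in s then form x e else 0.
Proof.
move=> us sE Ee; rewrite /proj_seq.
have -> : form (\sum_(f <- s) form x f *: f) e = \sum_(f <- s) form x f * form f e.
  elim: s {us sE} => [|f s IH]; first by rewrite !big_nil /= formC linear0r conjc0.
  by rewrite !big_cons formDl formZl IH.
have -> : \sum_(f <- s) form x f * form f e = \sum_(f <- s | f == e) form x f.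
  rewrite [RHS]big_mkcond /=; apply: eq_big_seq => f fs.
  by rewrite (Eonb.1 _ _ (sE _ fs) Ee); case: eqP; rewrite ?mulr1 ?mulr0.
case: ifPn => es; last first.
  by rewrite big_seq_cond big1 // => f /andP[fs /eqP fe]; rewrite -fe fs in es.
by rewrite -big_filter filter_pred1_uniq // big_seq1.
Qed.

(** Pythagoras, kept as an equality with the residual: it gives Bessel's inequality, the decrease of
    residuals and, once residuals are small, Parseval. *)
Lemma bessel s x : uniq s -> (forall e, e \in s -> E e) ->
  ip x x = ip (x - proj_seq s x) (x - proj_seq s x) + \sum_(e <- s) csq (form x e).
Proof.
move=> us sE; set p := proj_seq s x.
have pe e : e \in s -> form (x - p) e = 0.
  move=> es; rewrite formDl formNl form_proj_seq ?es ?subrr //; exact: sE.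
have lin y : ip y p = \sum_(e <- s) complex.Re ((form x e)^*%C * form y e).
  rewrite /p /proj_seq; elim: s {us sE p pe} => [|f s IH]; first by rewrite !big_nil ip0r.
  by rewrite !big_cons ipDr IH /ip linearZr_LR.
have xp : ip (x - p) p = 0.
  by rewrite lin big_seq big1 // => e es; rewrite pe // mulr0.
have pp : ip p p = \sum_(e <- s) csq (form x e).
  have -> : ip p p = ip x p by move/eqP : xp; rewrite ipBl subr_eq0 eq_sym => /eqP.
  by rewrite lin; apply: eq_bigr => e _; rewrite mulrC -csqE.
rewrite -pp -{1 2}(subrK p x) !ipE in xp *.
by move: xp; rewrite (ipC form p x); lra.
Qed.

Lemma proj_seqD s x y : proj_seq s (x + y) = proj_seq s x + proj_seq s y.
Proof.
rewrite /proj_seq -big_split; apply: eq_bigr => e _.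
by rewrite formDl scalerDl.
Qed.

Lemma proj_seqZ s (a : R[i]) x : proj_seq s (a *: x) = a *: proj_seq s x.
Proof.
rewrite /proj_seq scaler_sumr; apply: eq_bigr => e _.
by rewrite formZl scalerA.
Qed.

Lemma residual_le s t x : uniq s -> uniq t -> (forall e, e \in t -> E e) ->
  {subset s <= t} -> nm (x - proj_seq t x) <= nm (x - proj_seq s x).
Proof.
move=> us ut tE st; apply: nm_le => //; first exact: nm_ge0.
rewrite nm_sqr //; have := bessel x ut tE.
have sE e : e \in s -> E e by move=> /st /tE.
rewrite (bessel x us sE).
have := ler_sum_subseq us ut st (fun e => csq_ge0 (form x e)).
lra.
Qed.

Definition approximable x := forall r, 0 < r ->
  exists s, [/\ uniq s, (forall e, e \in s -> E e) & nm (x - proj_seq s x) < r].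

(** The approximable vectors form a subspace containing the basis. For [p] nearest to [x] in its
    closure, [x - p] is orthogonal to the basis, so [x = p]; and a limit of approximable vectors is
    approximable since [proj_seq s] is a contraction. *)
Lemma approximable_all x : approximable x.
Proof.
have resid0 s : proj_seq s 0 = 0.
  by rewrite -[X in proj_seq s X](scale0r (0 : h)) proj_seqZ scale0r.
have [|||p [[u uN up] xp]] := @projection_exists _ _ _ form_hilbert approximable x.
- by move=> r r0; exists [::]; split=> //; rewrite resid0 subrr nm0.
- move=> y z Ny Nz r r0.
  have r2 : 0 < r / 2 by rewrite divr_gt0.
  have [s [us sE sy]] := Ny _ r2; have [t [ut tE tz]] := Nz _ r2.
  have uE e : e \in undup (s ++ t) -> E e.
    by rewrite mem_undup mem_cat => /orP[/sE|/tE].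
  exists (undup (s ++ t)); split => //; first exact: undup_uniq.
  rewrite proj_seqD opprD addrACA [ltRHS](splitr r).
  apply: le_lt_trans (nmD form_hilbert _ _) _; apply: ltrD.
    apply: le_lt_trans sy; apply: residual_le => //; first exact: undup_uniq.
    by move=> e es; rewrite mem_undup mem_cat es.
  apply: le_lt_trans tz; apply: residual_le => //; first exact: undup_uniq.
  by move=> e es; rewrite mem_undup mem_cat es orbT.
- move=> a y Ny r r0.
  have a0 : 0 < Num.sqrt (csq a) + 1 by rewrite ltr_wpDl ?sqrtr_ge0.
  have [s [us sE sy]] := Ny (r / (Num.sqrt (csq a) + 1)) (divr_gt0 r0 a0).
  exists s; split => //; rewrite proj_seqZ -scalerBr nm_scale.
  rewrite ltr_pdivlMr // in sy; apply: le_lt_trans sy.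
  by rewrite mulrC ler_wpM2l ?nm_ge0 // lerDl.
have -> : x = p.
  apply/eqP; rewrite -subr_eq0; apply/eqP; apply: Eonb.2 => e Ee.
  apply: xp => r r0; exists [:: e]; split => //.
    by move=> f; rewrite inE => /eqP ->.
  by rewrite /proj_seq big_seq1 (Eonb.1 e e Ee Ee) eqxx scale1r subrr nm0.
move=> r r0; have r3 : 0 < r / 3 by rewrite divr_gt0.
move/cvgrPdist_lt : up => /(_ _ r3) [n _ /(_ n (leqnn n))].
rewrite sub0r normrN ger0_norm ?nm_ge0 // => un.
have [s [us sE su]] := uN n _ r3; exists s; split => //.
have -> : p - proj_seq s p = (p - u n) + (u n - proj_seq s (u n)) + proj_seq s (u n - p).
  rewrite proj_seqD -[X in _ + (_ + proj_seq _ X)]scaleN1r proj_seqZ scaleN1r.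
  by rewrite !addrA !subrK.
have pu : nm (proj_seq s (u n - p)) <= nm (u n - p).
  apply: nm_le => //; first exact: nm_ge0.
  rewrite nm_sqr // [leRHS](bessel _ us sE).
  have := bessel (proj_seq s (u n - p)) us sE.
  have -> : \sum_(e <- s) csq (form (proj_seq s (u n - p)) e) =
            \sum_(e <- s) csq (form (u n - p) e).
    apply: eq_big_seq => e es; rewrite form_proj_seq ?es //; exact: sE.
  have -> : proj_seq s (proj_seq s (u n - p)) = proj_seq s (u n - p).
    rewrite {1 3}/proj_seq; apply: eq_big_seq => e es.
    rewrite form_proj_seq ?es //; exact: sE.
  rewrite subrr ip0l => ->; rewrite add0r lerDr; exact: ip_ge0.
have := nmD form_hilbert (p - u n + (u n - proj_seq s (u n))) (proj_seq s (u n - p)).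
have := nmD form_hilbert (p - u n) (u n - proj_seq s (u n)).
rewrite (nmC form p (u n)).
lra.
Qed.

Lemma parseval x : (\esum_(e in E) (csq (form x e))%:E = (ip x x)%:E)%E.
Proof.
apply/eqP; rewrite eq_le; apply/andP; split.
  apply: esum_le_seqP => s us sE; rewrite (bessel x us sE) lerDr; exact: ip_ge0.
apply/lee_addgt0Pr => e e0.
(* The residual enters [bessel] squared, hence the radius [Num.sqrt e]. *)
have [s [us sE sx]] := @approximable_all x (Num.sqrt e) ltac:(by rewrite sqrtr_gt0).
apply: le_trans (leeD2r _ (esum_ge_seq _ us sE)).
rewrite -EFinD lee_fin (bessel x us sE) addrC lerD2l -(nm_sqr form_hilbert).
by rewrite -[leRHS](@sqr_sqrtr _ e) ?ler_sqr ?nnegrE ?nm_ge0 ?sqrtr_ge0 ?ltW.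
Qed.

End Basis.
End OrthonormalBases.

(** * Adjoint pairs and projections *)

Section Operators.
Context {R : realType} {h : completeNormedModType R[i]}.
Variable form : {dot h for Num.conj}.
Hypothesis form_hilbert : hilbert_form form.
Implicit Types (x y z : h) (r M : R) (A B C S T : h -> h) (N : set h).

Local Notation ip := (inner form).
Local Notation nm := (hnorm form).
Local Notation cvs := (hcvg form).

(** Carrying a formal adjoint along replaces linearity hypotheses: an operator that has one is
    automatically linear ([adjD], [adjZ]). *)
Definition adjoint_pair A A' := forall x y, form (A x) y = form x (A' y).

Definition bounded_by A M := forall x, nm (A x) <= M * nm x.

Lemma form_ext x y : (forall z, form x z = form y z) -> x = y.
Proof.
by move=> xy; apply: (@ip_ext _ _ _ form_hilbert) => z; rewrite /inner xy.
Qed.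

Lemma form0l x : form 0 x = 0.
Proof. by rewrite -(scale0r (0 : h)) formZl mul0r. Qed.

Lemma form_eq0C x y : form x y = 0 -> form y x = 0.
Proof. by move=> xy; rewrite formC xy conjc0. Qed.

Lemma adjoint_pair_sym A A' : adjoint_pair A A' -> adjoint_pair A' A.
Proof. by move=> AA x y; rewrite formC -AA -formC. Qed.

Section AdjointPair.
Variables (A A' : h -> h).
Hypothesis AA : adjoint_pair A A'.

Lemma adjD x y : A (x + y) = A x + A y.
Proof. by apply: form_ext => z; rewrite formDl !AA formDl. Qed.

Lemma adjZ (a : R[i]) x : A (a *: x) = a *: A x.
Proof. by apply: form_ext => z; rewrite formZl !AA formZl. Qed.

Lemma adjRS r x : A (rs r x) = rs r (A x). Proof. exact: adjZ. Qed.

Lemma adjI x : A (iC x) = iC (A x). Proof. exact: adjZ. Qed.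

Lemma adjN x : A (- x) = - A x.
Proof. by rewrite -scaleN1r adjZ scaleN1r. Qed.

Lemma adjB x y : A (x - y) = A x - A y.
Proof. by rewrite adjD adjN. Qed.

Lemma adj0 : A 0 = 0.
Proof. by have := adjB 0 0; rewrite !subrr. Qed.

Lemma adj_ip x y : ip (A x) y = ip x (A' y).
Proof. by rewrite /inner AA. Qed.

Lemma adj_linear : linear A.
Proof. by move=> a x y; rewrite adjD adjZ. Qed.

End AdjointPair.

Lemma adjoint_pair_of_ip A A' : (forall x, A' (iC x) = iC (A' x)) ->
  (forall x y, ip (A x) y = ip x (A' y)) -> adjoint_pair A A'.
Proof. by move=> AI Aip x y; rewrite !formE !Aip AI. Qed.

Lemma adjoint_pair_comp A A' B B' : adjoint_pair A A' -> adjoint_pair B B' ->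
  adjoint_pair (A \o B) (B' \o A').
Proof. by move=> AA BB x y; rewrite /= AA BB. Qed.

Lemma formDr x y z : form x (y + z) = form x y + form x z.
Proof. exact: linearDr. Qed.

Lemma formNr x y : form x (- y) = - form x y.
Proof. exact: linearNr. Qed.

Lemma form_rsl r x y : form (rs r x) y = r%:C%C * form x y.
Proof. exact: formZl. Qed.

Lemma form_rsr r x y : form x (rs r y) = r%:C%C * form x y.
Proof. 
rewrite formC form_rsl (formC form y x).
by case: (form y x) => a b; apply/eqP; rewrite eq_complex /=; apply/andP; split; apply/eqP; ring. Qed.

Lemma adjoint_pairD A A' B B' : adjoint_pair A A' -> adjoint_pair B B' ->
  adjoint_pair (fun x => A x + B x) (fun x => A' x + B' x).
Proof. by move=> AA BB x y; rewrite formDl formDr AA BB. Qed.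

Lemma adjoint_pairN A A' : adjoint_pair A A' ->
  adjoint_pair (fun x => - A x) (fun x => - A' x).
Proof. by move=> AA x y; rewrite formNl formNr AA. Qed.

Lemma adjoint_pairB A A' B B' : adjoint_pair A A' -> adjoint_pair B B' ->
  adjoint_pair (fun x => A x - B x) (fun x => A' x - B' x).
Proof. by move=> AA BB; apply: adjoint_pairD => //; exact: adjoint_pairN. Qed.

Lemma adjoint_pair_rs r A A' : adjoint_pair A A' ->
  adjoint_pair (fun x => rs r (A x)) (fun x => rs r (A' x)).
Proof. by move=> AA x y; rewrite form_rsl form_rsr AA. Qed.

Lemma bounded_by_le A M M' : M <= M' -> bounded_by A M -> bounded_by A M'.
Proof.
by move=> MM AM x; apply: le_trans (AM x) _; rewrite ler_wpM2r // nm_ge0.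
Qed.

Lemma bounded_by_ge0 A M : bounded_by A M -> exists2 M', 0 <= M' & bounded_by A M'.
Proof.
move=> AM; exists `|M| => //; apply: bounded_by_le AM; exact: ler_norm.
Qed.

Lemma bounded_opP A : bounded_op A <-> linear A /\ exists M, bounded_by A M.
Proof.
split=> [[lA cA]|[lA [M AM]]]; split => //.
  pose f : {linear h -> h} := HB.pack A (GRing.isLinear.Build _ _ _ _ A lA).
  have : bounded_near f (nbhs 0) by apply/linear_bounded_continuous.
  move/linear_boundedP => [K [Kr KA]].
  have r1 : K < (complex.Re `|K| + 1)%:C%C.
    have -> : K = (complex.Re K)%:C%C by rewrite RRe_real.
    rewrite ltcR normc_def /= expr0n addr0 sqrtr_sqr.
    by rewrite ltr_pwDr // ler_norm.
  exists (complex.Re `|K| + 1) => x.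
  have := KA _ r1 x; rewrite !(nmE form_hilbert) -rmorphM lecR.
  exact.
have [M' M'0 AM'] := bounded_by_ge0 AM.
pose f : {linear h -> h} := HB.pack A (GRing.isLinear.Build _ _ _ _ A lA).
suff : bounded_near f (nbhs 0) by move/linear_bounded_continuous.
apply/linear_boundedP; exists M'%:C%C; split; first by rewrite complex_real.
move=> k Mk x; apply: (@le_trans _ _ (M'%:C%C * `|x|)).
  by rewrite !(nmE form_hilbert) -rmorphM lecR; exact: AM'.
by rewrite ler_wpM2r // ltW.
Qed.

Lemma selfadjoint_bounded_op T M : selfadjoint form T -> bounded_by T M -> bounded_op T.
Proof.
by move=> Ts TM; apply/bounded_opP; split; [exact: adj_linear Ts|exists M].
Qed.

Lemma bounded_by_lipschitz A A' M : adjoint_pair A A' -> bounded_by A M ->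
  forall x y, nm (A x - A y) <= M * nm (x - y).
Proof. by move=> AA AM x y; rewrite -(adjB AA). Qed.

Lemma cvs_op A A' M u x : adjoint_pair A A' -> bounded_by A M ->
  cvs u x -> cvs (A \o u) (A x).
Proof.
by move=> AA AM; apply: cvs_lipschitz => //; exact: bounded_by_lipschitz AA AM.
Qed.

Lemma selfadjoint_real T x : selfadjoint form T -> form (T x) x = (ip (T x) x)%:C%C.
Proof.
move=> Ts; rewrite formE; congr (_ +i* _)%C.
rewrite ip_iCr; have := Ts x x; rewrite [RHS]formC.
by case: (form (T x) x) => a b [] /= bN; apply/eqP; rewrite -[_ == _](mulrn_eq0 b 2) mulr2n {1}bN addNr.
Qed.

Lemma positive_op_ip T : selfadjoint form T ->
  positive_op form T <-> forall x, 0 <= ip (T x) x.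
Proof.
by move=> Ts; split => T0 x; have := T0 x; rewrite selfadjoint_real // ler0c.
Qed.

(** Polarization: the form of [T] has no imaginary part at [x + y], which makes the cross terms
    antisymmetric; replacing [y] by [iC y] turns this into symmetry of the real part. *)
Lemma positive_op_selfadjoint T : linear T -> positive_op form T -> selfadjoint form T.
Proof.
move=> lT T0.
have TD x y : T (x + y) = T x + T y by have := lT 1 x y; rewrite !scale1r.
have T00 : T 0 = 0 by apply: (addIr (T 0)); rewrite -TD !add0r.
have TZ a x : T (a *: x) = a *: T x by have := lT a x 0; rewrite T00 !addr0.
have Tim x : ip (T x) (iC x) = 0 by rewrite ip_iCr; exact: ger0_Im (T0 x).
have TI x : T (iC x) = iC (T x) by exact: TZ.
have q x y : ip (T x) (iC y) = - ip (T y) (iC x).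
  have := Tim (x + y); rewrite TD iCD !ipE !Tim; lra.
apply: adjoint_pair_of_ip => // x y.
have := q x (iC y); rewrite iCiC ipNr TI ip_iCl iCiC ipNr.
rewrite (ipC form (T y) x); lra.
Qed.

Lemma positive_cauchy_schwarz T : selfadjoint form T -> (forall x, 0 <= ip (T x) x) ->
  forall x y, ip (T x) y ^+ 2 <= ip (T x) x * ip (T y) y.
Proof.
move=> Ts T0; apply: (@psd_cauchy_schwarz _ _ form) => //.
- exact: adjD Ts.
- exact: adjRS Ts.
- exact: adj_ip Ts.
Qed.

Lemma positive_eq0 T x : selfadjoint form T -> (forall x, 0 <= ip (T x) x) ->
  ip (T x) x = 0 -> T x = 0.
Proof.
move=> Ts T0 Tx; apply: (@ip_eq0 _ _ form) => //; apply/eqP.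
rewrite -sqrf_eq0 eq_le sqr_ge0 andbT.
by apply: le_trans (positive_cauchy_schwarz Ts T0 _ _) _; rewrite Tx mul0r.
Qed.

(** Cauchy-Schwarz for [T] between [x] and [T x], divided by the squared norm of [T x]. *)
Lemma positive_bound T M : selfadjoint form T -> (forall x, 0 <= ip (T x) x) ->
  0 <= M -> (forall x, ip (T x) x <= M * ip x x) -> bounded_by T M.
Proof.
move=> Ts T0 M0 TM x; apply: nm_le => //; first by rewrite mulr_ge0 // nm_ge0.
have := positive_cauchy_schwarz Ts T0 x (T x).
have [->|Tx0] := eqVneq (ip (T x) (T x)) 0; first by rewrite sqr_ge0.
have Tp : 0 < ip (T x) (T x) by rewrite lt_neqAle eq_sym Tx0 ip_ge0.
rewrite exprMn nm_sqr // => cs; rewrite -(ler_pM2r Tp) -expr2.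
apply: le_trans cs _; rewrite (_ : M ^+ 2 * _ * _ = (M * ip x x) * (M * ip (T x) (T x))); last by ring.
by apply: ler_pM.
Qed.

Lemma adjoint_pair_unique T S : selfadjoint form T -> adjoint_pair T S -> S = T.
Proof.
move=> Ts TS; apply/funext => x; apply: form_ext => y.
by rewrite (adjoint_pair_sym TS) Ts.
Qed.

Lemma adjoint_selfadjoint T : selfadjoint form T -> adjoint form T = T.
Proof.
move=> Ts; apply: adjoint_pair_unique => //.
by apply: (@getPex _ [set S | forall x y, form (T x) y = form x (S y)]); exists T.
Qed.

Section OrthProj.
Variable N : set h.
Hypothesis N0 : N 0.
Hypothesis ND : forall y z, N y -> N z -> N (y + z).
Hypothesis NZ : forall (a : R[i]) y, N y -> N (a *: y).
Hypothesis Ncl : forall u p, (forall n, N (u n)) -> cvs u p -> N p.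

Local Notation P := (orth_proj form N).

Lemma orth_projP x : N (P x) /\ forall y, N y -> form (x - P x) y = 0.
Proof.
apply: (@getPex _ [set p | N p /\ forall y, N y -> form (x - p) y = 0]).
have [p [[u uN up] pN]] := projection_exists form_hilbert x N0 ND NZ.
by exists p; split => //; exact: Ncl up.
Qed.

Lemma orth_proj_selfadjoint : selfadjoint form P.
Proof.
move=> x y; have [Nx xP] := orth_projP x; have [Ny yP] := orth_projP y.
have := xP _ Ny; rewrite formDl formNl => /eqP; rewrite subr_eq0 => /eqP ->.
apply/eqP; rewrite -subr_eq0 -formNr -formDr; apply/eqP.
by apply: form_eq0C; exact: yP.
Qed.

Lemma orth_proj_id x : N x -> P x = x.
Proof.
move=> Nx; have [NP xP] := orth_projP x.
apply/esym/eqP; rewrite -subr_eq0; apply/eqP.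
apply: form_ext => z; rewrite form0l.
have : form (x - P x) (x - P x) = 0.
  by apply: xP; apply: ND => //; rewrite -scaleN1r; exact: NZ.
by move/(congr1 (@complex.Re R)) => /(ip_eq0 form_hilbert) ->; rewrite form0l.
Qed.

Lemma orth_proj_bound : bounded_by P 1.
Proof.
have Ps := orth_proj_selfadjoint.
have PP x : P (P x) = P x by apply: orth_proj_id; have [] := orth_projP x.
have PE x : ip (P x) x = ip (P x) (P x) by rewrite -(adj_ip Ps) PP.
apply: positive_bound => // x; first by rewrite PE ip_ge0.
rewrite mul1r PE.
have := ip_ge0 form_hilbert (x - P x); rewrite !ipE (ipC form x) !PE; lra.
Qed.

End OrthProj.

Lemma kernel_closed A A' M : adjoint_pair A A' -> bounded_by A M ->
  forall u p, (forall n, null_space A (u n)) -> cvs u p -> null_space A p.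
Proof.
move=> AA AM u p uN up; have := cvs_op AA AM up.
have -> : A \o u = cst 0 by apply/funext => n; exact: uN.
by move=> /(cvs_unique form_hilbert (cvs_cst form 0)).
Qed.

Lemma kernelD A A' : adjoint_pair A A' -> forall y z,
  null_space A y -> null_space A z -> null_space A (y + z).
Proof. by move=> AA y z; rewrite /null_space /= (adjD AA) => -> ->; rewrite addr0. Qed.

Lemma kernelZ A A' : adjoint_pair A A' -> forall (a : R[i]) y,
  null_space A y -> null_space A (a *: y).
Proof. by move=> AA a y; rewrite /null_space /= (adjZ AA) => ->; rewrite scaler0. Qed.

End Operators.

(** * Square roots and Jordan decomposition *)

Section SquareRoot.
Context {R : realType} {h : completeNormedModType R[i]}.
Variable form : {dot h for Num.conj}.
Hypothesis form_hilbert : hilbert_form form.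
Implicit Types (x y z : h) (r M : R) (A B C S T : h -> h).

Local Notation ip := (inner form).
Local Notation nm := (hnorm form).
Local Notation cvs := (hcvg form).
Local Notation bounded_by := (bounded_by form).
Local Notation adjoint_pair := (adjoint_pair form).
Local Notation selfadjoint := (selfadjoint form).

Definition psd_op T := [/\ selfadjoint T, forall x, 0 <= ip (T x) x &
  exists M, bounded_by T M].

Lemma psd_opP T : psd_op T <-> bounded_op T /\ positive_op form T.
Proof.
split=> [[Ts T0 [M TM]]|[/bounded_opP-/(_ form form_hilbert)[Tl TM] T0]].
  split; first exact: (selfadjoint_bounded_op form_hilbert Ts TM).
  exact/(positive_op_ip Ts).
have Ts := positive_op_selfadjoint Tl T0.
by split => //; exact/(positive_op_ip Ts).
Qed.

Lemma bounded_byD A B M M' : bounded_by A M -> bounded_by B M' ->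
  bounded_by (fun x => A x + B x) (M + M').
Proof.
move=> AM BM x; apply: le_trans (nmD form_hilbert _ _) _.
by rewrite mulrDl lerD.
Qed.

Lemma bounded_byN A M : bounded_by A M -> bounded_by (fun x => - A x) M.
Proof. by move=> AM x; rewrite nmN. Qed.

Lemma bounded_byB A B M M' : bounded_by A M -> bounded_by B M' ->
  bounded_by (fun x => A x - B x) (M + M').
Proof. by move=> AM BM; apply: bounded_byD => //; exact: bounded_byN. Qed.

Lemma bounded_by_rs A M r : bounded_by A M ->
  bounded_by (fun x => rs r (A x)) (`|r| * M).
Proof. by move=> AM x; rewrite nmZ -mulrA ler_wpM2l. Qed.

Lemma bounded_by_comp A B M M' : bounded_by A M -> bounded_by B M' ->
  bounded_by (A \o B) (`|M| * M').
Proof.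
move=> AM BM x; apply: le_trans (AM _) _; rewrite -mulrA.
apply: (@le_trans _ _ (`|M| * nm (B x))); last by rewrite ler_wpM2l.
by rewrite ler_wpM2r ?nm_ge0 ?ler_norm.
Qed.

Lemma bounded_by_id : bounded_by (fun x => x) 1.
Proof. by move=> x; rewrite mul1r. Qed.

Lemma selfadjoint_lim (A_ : nat -> h -> h) A : (forall n, selfadjoint (A_ n)) ->
  (forall x, cvs (fun n => A_ n x) (A x)) -> selfadjoint A.
Proof.
move=> sA cA.
have AI x : A (iC x) = iC (A x).
  apply: (cvs_unique form_hilbert (cA _)).
  rewrite [X in hcvg _ X _](_ : _ = (fun n => iC (A_ n x))); first exact: cvs_iC.
  by apply/funext => n; rewrite (adjI form_hilbert (sA n)).
apply: adjoint_pair_of_ip => // x y.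
have c1 := cvs_ip form_hilbert (y := y) (cA x).
have := cvs_ip form_hilbert (y := x) (cA y).
rewrite [X in X @ _ --> _](_ : _ = (fun n => ip (A_ n x) y)); last first.
  by apply/funext => n; rewrite (adj_ip (sA n)) ipC.
move=> c2; have e1 := cvg_lim (@Rhausdorff R) c1.
by rewrite -e1 (cvg_lim (@Rhausdorff R) c2) ipC.
Qed.

Section Contraction.
Variable B : h -> h.
Hypothesis Bs : selfadjoint B.
Hypothesis B1 : bounded_by B 1.

(** Iteration for [Y = (B + Y^2) / 2], started at 0. With [B = 1 - A] a solution satisfies
    [(1 - Y)^2 = A]. *)
Fixpoint root_iter (n : nat) : h -> h :=
  if n is n.+1 then fun x => rs 2^-1 (B x + root_iter n (root_iter n x))
  else fun=> 0.

(** The same iteration for the scalar [B = 1]; it majorizes the norms of the iterates and of their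
    increments. *)
Fixpoint root_bound (n : nat) : R :=
  if n is n.+1 then (1 + root_bound n ^+ 2) / 2 else 0.

Lemma root_bound_ge0_le1 n : 0 <= root_bound n <= 1.
Proof.
elim: n => [|n /andP[y0 y1]] /=; first by rewrite lexx ler01.
have : root_bound n ^+ 2 <= 1 by rewrite expr_le1.
by have := sqr_ge0 (root_bound n); move=> *; apply/andP; split; lra.
Qed.

Lemma root_boundS n : root_bound n <= root_bound n.+1.
Proof. by have := sqr_ge0 (1 - root_bound n); rewrite /=; lra. Qed.

Lemma root_bound_nd : {homo root_bound : m n / (m <= n)%N >-> m <= n}.
Proof. by apply/nondecreasing_seqP; exact: root_boundS. Qed.

Lemma root_iter_selfadjoint n : selfadjoint (root_iter n).
Proof.
elim: n => [|n IH] /=; first by move=> x y; rewrite form0l // linear0r.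
apply: adjoint_pair_rs; apply: adjoint_pairD => //.
exact: (adjoint_pair_comp IH IH).
Qed.

Lemma root_iter_bound n : bounded_by (root_iter n) (root_bound n).
Proof.
elim: n => [|n IH] x /=; first by rewrite nm0 mul0r.
have /andP[y0 _] := root_bound_ge0_le1 n.
rewrite nmZ ger0_norm //.
have h1 := nmD form_hilbert (B x) (root_iter n (root_iter n x)).
have h2 := IH (root_iter n x).
have h3 := ler_wpM2l y0 (IH x).
have h4 := B1 x.
by rewrite expr2; lra.
Qed.

(** [Y^2 - Z^2 = Y (Y - Z) + (Y - Z) Z] bounds the increment by [(y + z) (y - z) / 2], with [y], [z]
    the scalar bounds of [Y], [Z]; this is exactly the next scalar increment. *)
Lemma root_iterS_le n x :
  nm (root_iter n.+1 x - root_iter n x) <= (root_bound n.+1 - root_bound n) * nm x.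
Proof.
elim: n x => [|n IH] x.
  rewrite /= addr0 subr0 subr0 nmZ ger0_norm //; have := B1 x; lra.
rewrite [root_iter n.+2 x]/= [X in _ - X]/=.
set Y := root_iter n.+1; set Z := root_iter n.
have -> : rs 2^-1 (B x + Y (Y x)) - rs 2^-1 (B x + Z (Z x)) =
          rs 2^-1 (Y (Y x - Z x) + (Y (Z x) - Z (Z x))).
  rewrite (adjB form_hilbert (root_iter_selfadjoint n.+1) : forall a b, Y (a - b) = _).
  by apply: (@ip_ext _ _ _ form_hilbert) => z; rewrite !ipE; ring.
rewrite nmZ ger0_norm //.
have /andP[y0 _] := root_bound_ge0_le1 n.+1.
have /andP[z0 _] := root_bound_ge0_le1 n.
have h1 := nmD form_hilbert (Y (Y x - Z x)) (Y (Z x) - Z (Z x)).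
have h2 := root_iter_bound n.+1 (Y x - Z x).
have h3 := ler_wpM2l y0 (IH x).
have h4 := IH (Z x).
have yz : 0 <= root_bound n.+1 - root_bound n by rewrite subr_ge0 root_boundS.
have h5 := ler_wpM2l yz (root_iter_bound n x).
rewrite -/Y -/Z in h1 h2 h3 h4 h5 *.
apply: (@le_trans _ _ (2^-1 * ((root_bound n.+1 + root_bound n) * ((root_bound n.+1 - root_bound n) * nm x)))).
  by rewrite ler_wpM2l //; lra.
have -> : root_bound n.+2 - root_bound n.+1 =
    2^-1 * ((root_bound n.+1 + root_bound n) * (root_bound n.+1 - root_bound n)).
  by rewrite /=; field.
by rewrite -!mulrA.
Qed.

Lemma root_iter_le m n x : (m <= n)%N ->
  nm (root_iter n x - root_iter m x) <= (root_bound n - root_bound m) * nm x.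
Proof.
elim: n => [|n IH]; first by rewrite leqn0 => /eqP ->; rewrite !subrr nm0 mul0r.
rewrite leq_eqVlt => /orP[/eqP ->|]; first by rewrite !subrr nm0 mul0r.
rewrite ltnS => /IH mn; have := root_iterS_le n x.
have := nmD form_hilbert (root_iter n.+1 x - root_iter n x) (root_iter n x - root_iter m x).
rewrite addrA subrK; lra.
Qed.

Lemma root_iter_lim : exists Y : h -> h, forall x, cvs (fun n => root_iter n x) (Y x).
Proof.
suff /choice[Y YP] : forall x, exists y, cvs (fun n => root_iter n x) y by exists Y.
move=> x.
have ub : has_ubound (range root_bound).
  by exists 1 => _ [n _ <-]; have /andP[] := root_bound_ge0_le1 n.
have cy : cvgn root_bound by apply: nondecreasing_is_cvgn => //; exact: root_bound_nd.
(* Operator increments are dominated by those of a convergent scalar sequence; the distance to its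
   limit is a Cauchy modulus. *)
apply: (hilbert_complete_le form_hilbert (d := fun m => (limn root_bound - root_bound m) * nm x)).
  move=> m n mn; apply: le_trans (root_iter_le x mn) _.
  rewrite ler_wpM2r ?nm_ge0 // lerD2r.
  by apply: nondecreasing_cvgn_le => //; exact: root_bound_nd.
rewrite -(mul0r (nm x)); apply: cvgM; last exact: cvg_cst.
by rewrite -(subrr (limn root_bound)); apply: cvgB => //; exact: cvg_cst.
Qed.

(** The commutation clause holds for the iterates, which are polynomials in [B], and passes to the
    limit. *)
Lemma contraction_root : exists Y : h -> h,
  [/\ selfadjoint Y, bounded_by Y 1, forall x, Y x = rs 2^-1 (B x + Y (Y x)) &
   forall C C' M, adjoint_pair C C' -> bounded_by C M ->
     (forall x, C (B x) = B (C x)) -> forall x, C (Y x) = Y (C x)].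
Proof.
have [Y cY] := root_iter_lim; exists Y.
have Ys : selfadjoint Y by apply: selfadjoint_lim cY; exact: root_iter_selfadjoint.
have Y1 : bounded_by Y 1.
  move=> x; apply: (ler_cvg_to (cvs_nm form_hilbert (cY x)) (cvg_cst (1 * nm x))).
  apply: nearW => n; apply: le_trans (root_iter_bound n x) _.
  by rewrite ler_wpM2r ?nm_ge0 //; have /andP[] := root_bound_ge0_le1 n.
split => //.
- move=> x; have cS : cvs (fun n => root_iter n.+1 x) (Y x).
    by have := cY x; rewrite /hcvg -(cvg_shiftS (fun n => nm (root_iter n x - Y x))).
  apply: (cvs_unique form_hilbert cS) => /=.
  apply: cvs_rs; apply: cvsD => //; first exact: cvs_cst.
  apply: (@cvs_of_le _ _ _ _ _ (fun n => nm (root_iter n x - Y x) + nm (root_iter n (Y x) - Y (Y x)))).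
    move=> n; have -> : root_iter n (root_iter n x) - Y (Y x) =
      root_iter n (root_iter n x - Y x) + (root_iter n (Y x) - Y (Y x)).
      by rewrite (adjB form_hilbert (root_iter_selfadjoint n)) addrA subrK.
    apply: le_trans (nmD form_hilbert _ _) _; rewrite lerD2r.
    apply: le_trans (root_iter_bound n _) _.
    by rewrite ler_piMl ?nm_ge0 //; have /andP[] := root_bound_ge0_le1 n.
  by rewrite -(addr0 0); apply: cvgD; exact: cY.
- move=> C C' M CC CM CB x; apply/esym; apply: (cvs_unique form_hilbert (cY _)).
  have Ci n z : C (root_iter n z) = root_iter n (C z).
    elim: n z => [|n IH] z /=; first by rewrite (adj0 form_hilbert CC).
    by rewrite (adjRS form_hilbert CC) (adjD form_hilbert CC) CB !IH.
  rewrite [X in hcvg _ X _](_ : _ = C \o (fun n => root_iter n x)).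
    exact: (cvs_op form_hilbert CC CM (cY x)).
  by apply/funext => n /=; rewrite Ci.
Qed.

End Contraction.

Theorem psd_sqrt_exists A : psd_op A -> exists S,
  [/\ psd_op S, S \o S = A &
   forall C C' M, adjoint_pair C C' -> bounded_by C M ->
     (forall x, C (A x) = A (C x)) -> forall x, C (S x) = S (C x)].
Proof.
move=> [As A0 [M0 AM0]].
(* Dividing by [M] gives [0 <= A / M <= 1], so [B = 1 - A / M] is a positive contraction; the added
   1 keeps [M] nonzero. *)
pose M := `|M0| + 1.
have Mp : 0 < M by rewrite ltr_wpDl.
have AM : bounded_by A M.
  by apply: bounded_by_le AM0; rewrite (le_trans (ler_norm _)) // lerDl.
pose B x := x - rs M^-1 (A x).
have Bs : selfadjoint B by apply: adjoint_pairB => //; exact: adjoint_pair_rs.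
have Aip x : ip (A x) x <= M * ip x x.
  apply: le_trans (ler_norm _) _; apply: le_trans (cauchy_schwarz form_hilbert _ _) _.
  by rewrite -nm_sqr // expr2 mulrA ler_wpM2r ?nm_ge0.
have B1 : bounded_by B 1.
  apply: positive_bound => // x; rewrite /B !ipE.
    by rewrite subr_ge0 mulrC ler_pdivrMr // mulrC.
  by rewrite mul1r gerBl mulr_ge0 // invr_ge0 ltW.
have [Y [Ys Y1 YE YC]] := contraction_root Bs B1.
pose S x := rs (Num.sqrt M) (x - Y x).
have Ss : selfadjoint S.
  by apply: (adjoint_pair_rs (A := fun x => x - Y x) (A' := fun x => x - Y x) _); apply: adjoint_pairB.
have SM : bounded_by S (`|Num.sqrt M| * (1 + 1)).
  apply: (bounded_by_rs (A := fun x => x - Y x)); apply: bounded_byB => //.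
  exact: bounded_by_id.
exists S; split.
- split => //; last by exists (`|Num.sqrt M| * (1 + 1)).
  move=> x; rewrite /S ipZl mulr_ge0 ?sqrtr_ge0 // ipBl subr_ge0.
  apply: le_trans (ler_norm _) _; apply: le_trans (cauchy_schwarz form_hilbert _ _) _.
  rewrite -nm_sqr // expr2 ler_wpM2r ?nm_ge0 //.
  by have := Y1 x; rewrite mul1r.
- apply/funext => x /=.
  have Y2 : Y (Y x) = rs 2 (Y x) - B x.
    by rewrite [in RHS]YE rsA divff // rs1 addrC addKr.
  rewrite /S (adjRS form_hilbert Ys) (adjB form_hilbert Ys) Y2 /B.
  apply: (@ip_ext _ _ _ form_hilbert) => z; rewrite !ipE.
  transitivity (Num.sqrt M ^+ 2 * (M^-1 * ip (A x) z)); first by ring.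
  by rewrite sqr_sqrtr ?ltW // mulrA divff ?mul1r // gt_eqF.
- move=> C C' K CC CK CA x; rewrite /S (adjRS form_hilbert CC) (adjB form_hilbert CC).
  rewrite (YC _ _ _ CC CK) // => y.
  by rewrite /B (adjB form_hilbert CC) (adjRS form_hilbert CC) CA.
Qed.

(** Any root [U] is compared with the constructed root [Q]. It commutes with its square, hence with
    [Q], so [(U + Q) y = 0] for [y = (U - Q) x]; positivity forces [U y = Q y = 0], and then
    [ip y y = ip x ((U - Q) y) = 0]. *)
Theorem psd_sqrt_unique S T : psd_op S -> psd_op T -> S \o S = T \o T -> S = T.
Proof.
have sq U : psd_op U -> psd_op (U \o U).
  move=> [Us U0 [M UM]]; split.
  - exact: adjoint_pair_comp.
  - by move=> x /=; rewrite (adj_ip Us); exact: ip_ge0.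
  - by exists (`|M| * M); exact: bounded_by_comp.
move=> Sp Tp ST.
have [Q [Qp QQ QC]] := psd_sqrt_exists (sq S Sp).
suff uni U : psd_op U -> U \o U = S \o S -> U = Q by rewrite (uni S) // (uni T).
move=> Up UU; have [Us U0 [M UM]] := Up; have [Qs Q0 _] := Qp.
have UQ : forall x, U (Q x) = Q (U x).
  by apply: (QC _ _ _ Us UM) => x; rewrite -UU.
apply/funext => x; pose y := U x - Q x.
have UQy : U y + Q y = 0.
  rewrite /y (adjB form_hilbert Us) (adjB form_hilbert Qs) UQ addrA subrK.
  by rewrite [U (U x)](congr1 (@^~ x) UU) [Q (Q x)](congr1 (@^~ x) QQ) subrr.
have Uy0 : ip (U y) y = 0 /\ ip (Q y) y = 0.
  have := congr1 (fun z => ip z y) UQy; rewrite /= ipDl ip0l.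
  by have := U0 y; have := Q0 y; move=> *; split; lra.
have Uy := positive_eq0 form_hilbert Us U0 Uy0.1.
have Qy := positive_eq0 form_hilbert Qs Q0 Uy0.2.
apply/eqP; rewrite -subr_eq0; apply/eqP; apply: (ip_eq0 form_hilbert).
by rewrite -/y {1}/y ipBl (adj_ip Us) (adj_ip Qs) Uy Qy !ip0r subrr.
Qed.

Section AbsoluteValue.
Variable T : h -> h.
Hypothesis Ts : selfadjoint T.
Hypothesis TM : exists M, bounded_by T M.

Let S := abs_op form T.

Lemma sqr_psd : psd_op (T \o T).
Proof.
have [M TM'] := TM; split.
- exact: adjoint_pair_comp.
- by move=> x /=; rewrite (adj_ip Ts); exact: ip_ge0.
- by exists (`|M| * M); exact: bounded_by_comp.
Qed.

Lemma abs_op_spec : psd_op S /\ S \o S = T \o T.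
Proof.
have [Q [Qp QQ _]] := psd_sqrt_exists sqr_psd.
have [|Sb S0 SS] := @getPex _ [set S : h -> h |
  [/\ bounded_op S, positive_op form S & S \o S = adjoint form T \o T]].
  by exists Q; have [] := (psd_opP Q).1 Qp; split => //; rewrite adjoint_selfadjoint.
rewrite -/(abs_op form T) -/S in Sb S0 SS.
by split; [exact/psd_opP|rewrite SS adjoint_selfadjoint].
Qed.

(** Uniqueness identifies the chosen [abs_op] with the constructed root, which commutes with [T]
    because [T] commutes with [T \o T]. *)
Lemma abs_op_comm x : T (S x) = S (T x).
Proof.
have [Q [Qp QQ QC]] := psd_sqrt_exists sqr_psd.
have [Sp SS] := abs_op_spec; have [M TM'] := TM.
have -> : S = Q by apply: psd_sqrt_unique => //; rewrite SS.
exact: (QC _ _ _ Ts TM').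
Qed.

Definition pos_part x := rs 2^-1 (S x + T x).
Definition neg_part x := rs 2^-1 (S x - T x).

Lemma pos_neg_parts x : T x = pos_part x - neg_part x.
Proof.
by apply: (@ip_ext _ _ _ form_hilbert) => z; rewrite /pos_part /neg_part !ipE; field.
Qed.

Lemma pos_partD_neg_part x : S x = pos_part x + neg_part x.
Proof.
by apply: (@ip_ext _ _ _ form_hilbert) => z; rewrite /pos_part /neg_part !ipE; field.
Qed.

Lemma pos_part_selfadjoint : selfadjoint pos_part.
Proof.
have [[Ss _ _] _] := abs_op_spec.
by apply: (adjoint_pair_rs (A := fun x => S x + T x) _); apply: adjoint_pairD.
Qed.

Lemma neg_part_selfadjoint : selfadjoint neg_part.
Proof.
have [[Ss _ _] _] := abs_op_spec.
by apply: (adjoint_pair_rs (A := fun x => S x - T x) _); apply: adjoint_pairB.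
Qed.

(** [(S - T) (S + T) = S^2 - T^2 = 0], the cross terms cancelling by [abs_op_comm]. *)
Lemma neg_pos_part x : neg_part (pos_part x) = 0.
Proof.
have [[Ss _ _] SS] := abs_op_spec.
rewrite /neg_part /pos_part (adjRS form_hilbert Ss) (adjRS form_hilbert Ts).
rewrite (adjD form_hilbert Ss) (adjD form_hilbert Ts) abs_op_comm.
rewrite [S (S x)](congr1 (@^~ x) SS).
by apply: (@ip_ext _ _ _ form_hilbert) => z; rewrite !ipE; ring.
Qed.

Lemma neg_part_bounded : exists M, bounded_by neg_part M.
Proof.
have [[Ss _ [K SK]] _] := abs_op_spec; have [M TM'] := TM.
exists (`|2^-1| * (K + M)).
by apply: (bounded_by_rs (A := fun x => S x - T x)); apply: bounded_byB.
Qed.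

Lemma pos_part_bounded : exists M, bounded_by pos_part M.
Proof.
have [[Ss _ [K SK]] _] := abs_op_spec; have [M TM'] := TM.
exists (`|2^-1| * (K + M)).
by apply: (bounded_by_rs (A := fun x => S x + T x)); apply: bounded_byD.
Qed.

(* P projects onto the kernel of the negative part, which contains the range
   of the positive part; so the positive part is P T P. *)
Lemma jordan_projection : exists P : h -> h,
  [/\ selfadjoint P, bounded_by P 1, (forall x, P (P x) = P x),
      (forall x, ip (pos_part x) x = ip (T (P x)) (P x)) &
      (forall x, ip (neg_part x) x = - ip (T (x - P x)) (x - P x))].
Proof.
have ns := neg_part_selfadjoint; have ps := pos_part_selfadjoint.
have [K nK] := neg_part_bounded.
have ND := kernelD form_hilbert ns; have NZ := kernelZ form_hilbert ns.
have N0 : null_space neg_part 0 by exact: (adj0 form_hilbert ns).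
have Ncl := kernel_closed form_hilbert ns nK.
pose P := orth_proj form (null_space neg_part).
have Ps : selfadjoint P := orth_proj_selfadjoint form_hilbert N0 ND NZ Ncl.
have nP x : neg_part (P x) = 0.
  by have [] := orth_projP form_hilbert N0 ND NZ Ncl x.
have Pp x : P (pos_part x) = pos_part x.
  by apply: orth_proj_id => //; exact: neg_pos_part.
have pP x : pos_part (P x) = pos_part x.
  by apply: (@ip_ext _ _ _ form_hilbert) => z; rewrite (adj_ip ps) (adj_ip Ps) Pp -(adj_ip ps).
exists P; split => //.
- exact: orth_proj_bound.
- by move=> x; apply: orth_proj_id.
- move=> x; rewrite pos_neg_parts nP subr0 pP -{1}Pp.
  exact: (adj_ip Ps).
- move=> x; rewrite pos_neg_parts (adjB form_hilbert ps) pP subrr sub0r ipNl opprK.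
  rewrite (adjB form_hilbert ns) nP subr0 ipBr (adj_ip ns x (P x)) nP ip0r subr0.
  by [].
Qed.

(** At vectors [P x] the form of the negative part vanishes, so there the positive part has the same
    form as [S], which is positive. *)
Lemma pos_part_psd : psd_op pos_part.
Proof.
have [P [Ps P1 PP pE nE]] := jordan_projection.
have [[Ss S0 _] _] := abs_op_spec.
split; [exact: pos_part_selfadjoint| |exact: pos_part_bounded].
move=> x; have pEP := pE (P x); have nEP := nE (P x); rewrite PP subrr ip0r oppr0 in nEP.
have := S0 (P x); rewrite pos_partD_neg_part ipDl nEP addr0 pEP PP -pE.
by [].
Qed.

Lemma neg_part_psd : psd_op neg_part.
Proof.
have [P [Ps P1 PP pE nE]] := jordan_projection.
have [[Ss S0 _] _] := abs_op_spec.
split; [exact: neg_part_selfadjoint| |exact: neg_part_bounded].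
move=> x; have pEP := pE (x - P x); have nEP := nE (x - P x).
have P0 : P (x - P x) = 0 by rewrite (adjB form_hilbert Ps) PP subrr.
rewrite P0 ip0r in pEP; rewrite P0 subr0 in nEP.
have := S0 (x - P x); rewrite pos_partD_neg_part ipDl pEP add0r nEP -nE.
by [].
Qed.

End AbsoluteValue.

Lemma abs_op_psd T : psd_op T -> abs_op form T = T.
Proof.
move=> Tp; have [Ts T0 TM] := Tp; have [Sp SS] := abs_op_spec Ts TM.
exact: psd_sqrt_unique.
Qed.

End SquareRoot.

(** * Trace norm *)

Section HilbertSchmidt.
Context {R : realType} {h : completeNormedModType R[i]}.
Variable form : {dot h for Num.conj}.
Hypothesis form_hilbert : hilbert_form form.
Implicit Types (x y z : h) (r M K : R) (A B C S T a b : h -> h) (f g : h -> R).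

Local Notation ip := (inner form).
Local Notation nm := (hnorm form).
Local Notation cvs := (hcvg form).
Local Notation bounded_by := (bounded_by form).
Local Notation adjoint_pair := (adjoint_pair form).
Local Notation selfadjoint := (selfadjoint form).
Local Notation psd_op := (psd_op form).
Local Notation Ts := (Ts form).
Local Notation Tspos := (Tspos form).
Local Notation tnorm := (tnorm form).

Definition onb_sum (f : h -> R) : \bar R := (\esum_(e in onb form) (f e)%:E)%E.

Lemma onb_sum_ge0 f : (forall e, 0 <= f e) -> (0 <= onb_sum f)%E.
Proof. by move=> f0; apply: esum_ge0 => e _; rewrite lee_fin. Qed.

Lemma onb_sumD f g : (forall e, 0 <= f e) -> (forall e, 0 <= g e) ->
  onb_sum (fun e => f e + g e) = (onb_sum f + onb_sum g)%E.
Proof.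
move=> f0 g0; rewrite /onb_sum -esumD => [|e _|e _]; rewrite ?lee_fin //.
Qed.

Lemma eq_onb_sum f g : (forall e, f e = g e) -> onb_sum f = onb_sum g.
Proof. by move=> fg; congr onb_sum; apply/funext. Qed.

Lemma le_onb_sum f g : (forall e, f e <= g e) -> (onb_sum f <= onb_sum g)%E.
Proof. by move=> fg; apply: le_esum => e _; rewrite lee_fin. Qed.

Lemma onb_sum_leM f g M K : 0 <= M -> (forall e, 0 <= g e) ->
  (forall e, f e <= M * g e) -> (onb_sum g <= K%:E)%E -> (onb_sum f <= (M * K)%:E)%E.
Proof.
move=> M0 g0 fg gK; apply: esum_le_seqP => s us sE.
apply: (@le_trans _ _ (M * \sum_(e <- s) g e)); first by rewrite mulr_sumr ler_sum.
rewrite ler_wpM2l // -lee_fin; apply: le_trans gK.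
exact: (esum_ge_seq (E := onb form)).
Qed.

(** A Fatou lemma: finite subsums pass to the limit, and the bound [K] holds for each of them. *)
Lemma onb_sum_le_lim (f_ : nat -> h -> R) f K :
  (forall e, f_ ^~ e @ \oo --> f e) -> (forall n, (onb_sum (f_ n) <= K%:E)%E) ->
  (onb_sum f <= K%:E)%E.
Proof.
move=> ff fK; apply: esum_le_seqP => s us sE.
have c : (fun n => \sum_(e <- s) f_ n e) @ \oo --> \sum_(e <- s) f e.
  elim: s {us sE} => [|e s IH].
    under eq_fun do rewrite big_nil; rewrite big_nil; exact: cvg_cst.
  by under eq_fun do rewrite big_cons; rewrite big_cons; apply: cvgD.
apply: (ler_cvg_to c (cvg_cst K)); apply: nearW => n.
rewrite -lee_fin; apply: le_trans (fK n).
exact: (esum_ge_seq (E := onb form)).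
Qed.

Lemma onb_sum_fineK f : (forall e, 0 <= f e) -> (onb_sum f < +oo)%E ->
  (fine (onb_sum f))%:E = onb_sum f.
Proof. by move=> f0 fK; rewrite fineK // ge0_fin_numE // onb_sum_ge0. Qed.

Lemma onb_sum0 f : (forall e, 0 <= f e) -> (onb_sum f <= 0)%E ->
  forall e, onb form e -> f e = 0.
Proof.
move=> f0 fs e Ee; apply/eqP; rewrite eq_le f0 andbT -lee_fin; apply: le_trans fs.
have := @esum_ge_seq _ _ (onb form) f [:: e] isT; rewrite big_seq1; apply.
by move=> d; rewrite inE => /eqP ->.
Qed.

(** [sum_over] splits the difference into its own positive and negative parts, in general not [f]
    and [g]; summability makes the two splittings give the same value. *)
Lemma sum_over_onbB f g : (forall e, 0 <= f e) -> (forall e, 0 <= g e) ->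
  (onb_sum f < +oo)%E -> (onb_sum g < +oo)%E ->
  sum_over (onb form) (fun e => f e - g e) = fine (onb_sum f) - fine (onb_sum g).
Proof.
move=> f0 g0 fK gK.
have sm u : (forall e, 0 <= u e) -> (onb_sum u < +oo)%E -> summable (onb form) (EFin \o u).
  move=> u0 uK; rewrite /summable; apply: le_lt_trans uK.
  by apply: le_esum => e _ /=; rewrite ger0_norm.
have sf := sm f f0 fK; have sg := sm g g0 gK.
have fin u : (forall e, (0 <= u e)%E) -> summable (onb form) u ->
    (\esum_(e in onb form) u e)%E \is a fin_num.
  move=> u0; rewrite summableE; congr (_ \is a fin_num).
  by apply: eq_esum => e _; rewrite gee0_abs.
have sfg := summableB sf sg.
rewrite /sum_over -fineB; last first.
- by apply: fin => [e|]; [exact: funeneg_ge0|exact: (summable_funeneg sfg)].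
- by apply: fin => [e|]; [exact: funepos_ge0|exact: (summable_funepos sfg)].
rewrite -fineB; last first.
- by rewrite ge0_fin_numE // onb_sum_ge0.
- by rewrite ge0_fin_numE // onb_sum_ge0.
congr fine; rewrite /onb_sum -(esumB sf sg) // => e _ /=; by rewrite lee_fin.
Qed.

(** * Squared Hilbert-Schmidt norms *)

Definition hs A : \bar R := onb_sum (fun e => ip (A e) (A e)).

Lemma hs_parseval A : hs A =
  (\esum_(e in onb form) \esum_(f in onb form) (csq (form (A e) f))%:E)%E.
Proof. by apply: eq_esum => e _; rewrite (parseval form_hilbert (onbP form_hilbert)). Qed.

(** By Parseval both sides are the double sum of [csq (form (A e) f)], read in the two orders. This
    exchange stands in for cyclicity of the trace. *)
Lemma hs_adjoint A A' : adjoint_pair A A' -> hs A = hs A'.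
Proof.
move=> AA; rewrite !hs_parseval.
rewrite !esum_esum; try by move=> *; rewrite lee_fin csq_ge0.
rewrite [RHS](@reindex_esum _ _ _ (onb form `*`` (fun=> onb form))
  (onb form `*`` (fun=> onb form)) (fun k => (k.2, k.1))); last first.
  split.
  - by move=> [x y] [].
  - by move=> [x y] [x' y'] _ _ [-> ->].
  - by move=> [x y] [/= Ex Ey]; exists (y, x).
by apply: eq_esum => -[x y] _ /=; rewrite AA formC csqJ.
Qed.

(** Multiplying [y] by [form x y] makes the form real, which reduces the complex inequality to the
    real one. *)
Lemma csq_form_le x y : csq (form x y) <= ip x x * ip y y.
Proof.
set c := form x y.
have cE : csq c = ip x (c *: y).
  by rewrite /inner linearZr_LR /= -/c mulrC -csqE.
have := cauchy_schwarz form_hilbert x (c *: y).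
rewrite -cE ger0_norm ?csq_ge0 // (nm_scale form_hilbert) => h1.
have [c0|c0] := eqVneq (csq c) 0; first by rewrite c0 mulr_ge0 // ip_ge0.
have cp : 0 < csq c by rewrite lt_neqAle eq_sym c0 csq_ge0.
rewrite -(ler_pM2r cp) -expr2.
apply: (@le_trans _ _ ((nm x * (Num.sqrt (csq c) * nm y)) ^+ 2)).
  by rewrite ler_sqr ?nnegrE ?mulr_ge0 ?nm_ge0 ?sqrtr_ge0 // csq_ge0.
by rewrite !exprMn !nm_sqr // sqr_sqrtr ?csq_ge0 //; rewrite le_eqVlt; apply/orP; left; apply/eqP; ring.
Qed.

(** Parseval for [A x], with [form (A x) e = form x (A' e)] and Cauchy-Schwarz in each term. *)
Lemma hs_bound A A' K : adjoint_pair A A' -> (hs A' <= K%:E)%E -> 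
  forall x, ip (A x) (A x) <= K * ip x x.
Proof.
move=> AA hK x; rewrite -lee_fin -(parseval form_hilbert (onbP form_hilbert)) mulrC.
apply: onb_sum_leM hK => [|e|e]; [exact: ip_ge0|exact: ip_ge0|].
by rewrite AA csq_form_le.
Qed.

(** * Trace norm and positive cone *)

Lemma trace_absE T :
  trace_abs form T = onb_sum (fun e => ip (abs_op form T e) e).
Proof. by []. Qed.

Lemma TsP T : Ts T <-> [/\ selfadjoint T, exists M, bounded_by T M &
  (trace_abs form T < +oo)%E].
Proof.
split=> [[sT [/bounded_opP-/(_ form form_hilbert)[_ bT] tT]]|[sT [M bT] tT]] //.
by split => //; split => //; exact: (selfadjoint_bounded_op form_hilbert sT bT).
Qed.

Lemma psd_trace_abs a : psd_op a -> trace_abs form a = onb_sum (fun e => ip (a e) e).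
Proof.
by move=> ap; have [sa _ ba] := ap; rewrite trace_absE // abs_op_psd.
Qed.

Lemma TsposP a : Tspos a <-> psd_op a /\ (onb_sum (fun e => ip (a e) e) < +oo)%E.
Proof.
split=> [[/TsP[sa ba ta] /(positive_op_ip sa) a0]|[ap ta]].
  have ap : psd_op a by split.
  by split => //; rewrite -psd_trace_abs.
have [sa a0 ba] := ap; split; last exact/(positive_op_ip sa).
by apply/TsP; split => //; rewrite psd_trace_abs.
Qed.

Lemma TsposW a : Tspos a -> Ts a. Proof. by case. Qed.

Lemma Tspos_tnorm a : Tspos a -> onb_sum (fun e => ip (a e) e) = (tnorm a)%:E.
Proof.
move=> /TsposP[ap ta]; rewrite /Defs.tnorm psd_trace_abs // onb_sum_fineK //.
by case: ap.
Qed.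

Lemma tnorm_ge0 T : Ts T -> 0 <= tnorm T.
Proof.
move=> /TsP[sT bT tT]; apply: fine_ge0; rewrite trace_absE //.
have [[_ S0 _] _] := abs_op_spec form_hilbert sT bT; exact: onb_sum_ge0.
Qed.

Lemma Tspos_le a K : psd_op a -> (onb_sum (fun e => ip (a e) e) <= K%:E)%E ->
  Tspos a /\ tnorm a <= K.
Proof.
move=> ap aK; have ta : Tspos a.
  by apply/TsposP; split => //; exact: le_lt_trans aK (ltry _).
by split => //; rewrite -lee_fin -Tspos_tnorm.
Qed.

Lemma hs_sqrt a s : psd_op s -> s \o s = a -> hs s = onb_sum (fun e => ip (a e) e).
Proof.
by move=> [ss _ _] <-; apply: eq_onb_sum => e; rewrite /= [RHS](adj_ip ss).
Qed.

(** For the square root of [a], this bounds the operator norm by the Hilbert-Schmidt norm. *)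
Lemma Tspos_ip_le a x : Tspos a -> ip (a x) x <= tnorm a * ip x x.
Proof.
move=> ta; have [ap _] := (TsposP a).1 ta.
have [s [sp ssa _]] := psd_sqrt_exists form_hilbert ap; have [ss _ _] := sp.
have -> : ip (a x) x = ip (s x) (s x) by rewrite -ssa /= (adj_ip ss).
by apply: (hs_bound ss); rewrite (hs_sqrt sp ssa) Tspos_tnorm.
Qed.

Lemma Tspos_bound a : Tspos a -> bounded_by a (tnorm a).
Proof.
move=> ta; have [[sa a0 _] _] := (TsposP a).1 ta.
apply: positive_bound => //; first exact: tnorm_ge0 (TsposW ta).
by move=> x; exact: Tspos_ip_le.
Qed.

(** For [s] the square root of [a], the trace of [P a P] is the squared Hilbert-Schmidt norm of
    [s P], equal to that of its adjoint [P s], and [P] shrinks each [s e]. *)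
Lemma onb_sum_compress a P : psd_op a -> selfadjoint P -> bounded_by P 1 ->
  (onb_sum (fun e => ip (a (P e)) (P e)) <= onb_sum (fun e => ip (a e) e))%E.
Proof.
move=> ap sP P1; have [s [sp ssa _]] := psd_sqrt_exists form_hilbert ap.
have [ss _ _] := sp.
have -> : onb_sum (fun e => ip (a (P e)) (P e)) = hs (s \o P).
  by apply: eq_onb_sum => e; rewrite -ssa /= (adj_ip ss).
rewrite (hs_adjoint (adjoint_pair_comp ss sP)) -(hs_sqrt sp ssa).
apply: le_onb_sum => e; rewrite /= -!(nm_sqr form_hilbert) ler_sqr ?nnegrE ?nm_ge0 //.
by have := P1 (s e); rewrite mul1r.
Qed.

Lemma proj_compl_bound P : selfadjoint P -> (forall x, P (P x) = P x) ->
  bounded_by (fun x => x - P x) 1.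
Proof.
move=> sP PP x; rewrite mul1r; apply: nm_le => //; first exact: nm_ge0.
rewrite nm_sqr //; have PE : ip (P x) x = ip (P x) (P x) by rewrite -(adj_ip sP) PP.
have := ip_ge0 form_hilbert (P x); rewrite !ipE (ipC form x) !PE; lra.
Qed.

(* The positive part of T = a - b is P T P <= P a P for the projection P of the
   Jordan decomposition, whence its trace is at most that of a. *)
Lemma trace_abs_le T a b : selfadjoint T -> (exists M, bounded_by T M) ->
  psd_op a -> psd_op b -> (forall x, T x = a x - b x) ->
  (trace_abs form T <= onb_sum (fun e => ip (a e) e) + onb_sum (fun e => ip (b e) e))%E.
Proof.
move=> sT bT ap bp Tab.
have [P [sP P1 PP pE nE]] := jordan_projection form_hilbert sT bT.
have [_ p0 _] := pos_part_psd form_hilbert sT bT.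
have [_ n0 _] := neg_part_psd form_hilbert sT bT.
have [_ a0 _] := ap; have [_ b0 _] := bp.
rewrite trace_absE // (@eq_onb_sum _ (fun e => ip (pos_part form T e) e + ip (neg_part form T e) e)); last first.
  by move=> e; rewrite (pos_partD_neg_part form_hilbert) ipDl.
rewrite onb_sumD //; apply: leeD.
  apply: le_trans (onb_sum_compress ap sP P1).
  by apply: le_onb_sum => e; rewrite pE Tab ipBl gerBl.
have sQ : selfadjoint (fun x => x - P x) by apply: adjoint_pairB.
apply: le_trans (onb_sum_compress bp sQ (proj_compl_bound sP PP)).
by apply: le_onb_sum => e; rewrite nE Tab ipBl opprB gerBl.
Qed.

(** Any splitting into the cone yields membership and a norm bound; combined with the Jordan
    splitting, where equality holds, this yields the triangle inequality. *)
Lemma Ts_diff T a b : Tspos a -> Tspos b -> (forall x, T x = a x - b x) ->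
  Ts T /\ tnorm T <= tnorm a + tnorm b.
Proof.
move=> ta tb Tab.
have [ap _] := (TsposP a).1 ta; have [bp _] := (TsposP b).1 tb.
have [sa _ [Ma ba]] := ap; have [sb _ [Mb bb]] := bp.
have TE : T = fun x => a x - b x by apply/funext.
have sT : selfadjoint T by rewrite TE; exact: adjoint_pairB.
have bT : exists M, bounded_by T M by exists (Ma + Mb); rewrite TE; exact: bounded_byB.
have := trace_abs_le sT bT ap bp Tab.
rewrite !Tspos_tnorm // -EFinD => tT.
have tf : (trace_abs form T < +oo)%E by exact: le_lt_trans tT (ltry _).
split; first by apply/TsP.
rewrite -lee_fin /Defs.tnorm fineK // ge0_fin_numE // trace_absE //.
have [[_ S0 _] _] := abs_op_spec form_hilbert sT bT; exact: onb_sum_ge0.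
Qed.

Lemma jordan_decomposition T : Ts T -> exists a b,
  [/\ Tspos a, Tspos b, forall x, T x = a x - b x & tnorm T = tnorm a + tnorm b].
Proof.
move=> tT; have [sT bT Tf] := (TsP T).1 tT.
have pp := pos_part_psd form_hilbert sT bT.
have np := neg_part_psd form_hilbert sT bT.
have [_ p0 _] := pp; have [_ n0 _] := np.
have tE : trace_abs form T = (onb_sum (fun e => ip (pos_part form T e) e) +
    onb_sum (fun e => ip (neg_part form T e) e))%E.
  rewrite -onb_sumD // trace_absE //; apply: eq_onb_sum => e.
  by rewrite (pos_partD_neg_part form_hilbert) ipDl.
have tp : Tspos (pos_part form T).
  apply/TsposP; split => //; apply: le_lt_trans Tf; rewrite tE leeDl //; exact: onb_sum_ge0.
have tn : Tspos (neg_part form T).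
  apply/TsposP; split => //; apply: le_lt_trans Tf; rewrite tE leeDr //; exact: onb_sum_ge0.
exists (pos_part form T), (neg_part form T); split => //.
  by move=> x; exact: pos_neg_parts.
by rewrite {1}/Defs.tnorm tE !Tspos_tnorm.
Qed.

(** * Vector space structure and norm of the trace class *)

Lemma TsposD a b : Tspos a -> Tspos b ->
  Tspos (a + b) /\ tnorm (a + b) = tnorm a + tnorm b.
Proof.
move=> ta tb; have [[sa a0 [Ma ba]] _] := (TsposP a).1 ta.
have [[sb b0 [Mb bb]] _] := (TsposP b).1 tb.
have abp : psd_op (a + b).
  split; first exact: adjoint_pairD.
    by move=> x; rewrite fctE ipDl addr_ge0.
  by exists (Ma + Mb); exact: bounded_byD.
have sumE : onb_sum (fun e => ip ((a + b) e) e) = (tnorm a + tnorm b)%:E.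
  rewrite EFinD -!Tspos_tnorm // -onb_sumD //.
  by apply: eq_onb_sum => e; rewrite fctE ipDl.
have tab : Tspos (a + b) by apply/TsposP; split => //; rewrite sumE ltry.
split => //; have := Tspos_tnorm tab; rewrite sumE => -[] //.
Qed.

Lemma rscaleE r T x : rscale r T x = rs r (T x). Proof. by []. Qed.

Lemma Tspos_rscale r a : 0 <= r -> Tspos a ->
  Tspos (rscale r a) /\ tnorm (rscale r a) = r * tnorm a.
Proof.
have le q b : 0 <= q -> Tspos b -> Tspos (rscale q b) /\ tnorm (rscale q b) <= q * tnorm b.
  move=> q0 tb; have [[sb b0 [Mb bb]] _] := (TsposP b).1 tb.
  apply: Tspos_le.
    split; first exact: (adjoint_pair_rs q sb).
      by move=> x; rewrite rscaleE ipZl mulr_ge0.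
    by exists (`|q| * Mb); exact: bounded_by_rs.
  apply: (onb_sum_leM q0 b0); last by rewrite Tspos_tnorm.
  by move=> e; rewrite rscaleE ipZl.
move=> r0 ta; have [tra ra] := le r a r0 ta; split => //.
have [r00|r00] := eqVneq r 0.
  apply/eqP; rewrite eq_le ra r00 mul0r tnorm_ge0 //.
  by rewrite -r00; exact: TsposW.
have rp : 0 < r by rewrite lt_neqAle eq_sym r00.
apply/eqP; rewrite eq_le ra /=.
(* The reverse inequality is the same bound for the factor [r^-1]. *)
have rV0 : 0 <= r^-1 by rewrite invr_ge0.
have [_] := le _ _ rV0 tra.
have -> : rscale r^-1 (rscale r a) = a.
  by apply/funext => x; rewrite !rscaleE rsA mulVf // rs1.
by rewrite ler_pdivlMl.
Qed.

Lemma Tspos0 : Tspos 0 /\ tnorm 0 <= 0.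
Proof.
have bb : bounded_by (0 : h -> h) 0 by move=> x; rewrite mul0r nm0.
apply: Tspos_le; last first.
  have z e : ip ((0 : h -> h) e) e <= 0 * ip e e by rewrite mul0r ip0l.
  apply: esum_le_seqP => s _ _; rewrite big1 // => e _; exact: ip0l.
split; last by exists 0.
  by move=> x y; rewrite form0l // linear0r.
by move=> x; rewrite ip0l.
Qed.

Lemma TsD S T : Ts S -> Ts T -> Ts (S + T) /\ tnorm (S + T) <= tnorm S + tnorm T.
Proof.
move=> /jordan_decomposition[a [b [ta tb Sab ->]]].
move=> /jordan_decomposition[c [d [tc td Tcd ->]]].
have [tac eac] := TsposD ta tc; have [tbd ebd] := TsposD tb td.
have STE x : (S + T) x = (a + c) x - (b + d) x.
  by rewrite !fctE Sab Tcd opprD addrACA.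
have [tST STn] := Ts_diff tac tbd STE; split => //.
by apply: le_trans STn _; rewrite eac ebd; lra.
Qed.

Lemma Ts_rscale r T : Ts T -> Ts (rscale r T) /\ tnorm (rscale r T) <= `|r| * tnorm T.
Proof.
move=> /jordan_decomposition[a [b [ta tb Tab ->]]].
have [tra ea] := Tspos_rscale (normr_ge0 r) ta.
have [trb eb] := Tspos_rscale (normr_ge0 r) tb.
rewrite mulrDr -ea -eb; have [r0|r0] := leP 0 r.
  by apply: Ts_diff => // x; rewrite !rscaleE Tab rsDr rsNr ger0_norm.
rewrite addrC; apply: Ts_diff => // x.
by rewrite !rscaleE Tab rsDr rsNr ltr0_norm // !rsN opprK addrC.
Qed.

Lemma Ts0 : Ts 0. Proof. exact: TsposW Tspos0.1. Qed.

Lemma rscaleN1 T : rscale (-1) T = - T.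
Proof. by apply/funext => x; rewrite rscaleE rsN rs1. Qed.

Lemma TsN T : Ts T -> Ts (- T) /\ tnorm (- T) <= tnorm T.
Proof.
by move=> /(Ts_rscale (-1)); rewrite rscaleN1 normrN normr1 mul1r.
Qed.

Lemma TsB S T : Ts S -> Ts T -> Ts (S - T) /\ tnorm (S - T) <= tnorm S + tnorm T.
Proof.
move=> tS /TsN[tT nT]; have [tST nST] := TsD tS tT; split => //.
by apply: le_trans nST _; rewrite lerD2l.
Qed.

Lemma tnorm_rscale r T : Ts T -> tnorm (rscale r T) = `|r| * tnorm T.
Proof.
move=> tT; have [trT rT] := Ts_rscale r tT; apply/eqP; rewrite eq_le rT /=.
have [->|r0] := eqVneq r 0; first by rewrite normr0 mul0r (tnorm_ge0 (Ts_rscale 0 tT).1).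
have [_] := Ts_rscale r^-1 trT.
have -> : rscale r^-1 (rscale r T) = T.
  by apply/funext => x; rewrite !rscaleE rsA mulVf // rs1.
by rewrite normfV ler_pdivlMl // normr_gt0.
Qed.

Lemma Ts_bound T : Ts T -> bounded_by T (tnorm T).
Proof.
move=> /jordan_decomposition[a [b [ta tb Tab ->]]] x.
rewrite Tab; apply: bounded_byB => //; exact: Tspos_bound.
Qed.

Lemma tnorm_eq0 T : Ts T -> tnorm T = 0 -> T = 0.
Proof.
move=> tT T0; apply/funext => x; apply: (nm_eq0 form_hilbert).
apply/eqP; rewrite eq_le nm_ge0 andbT; apply: le_trans (Ts_bound tT x) _.
by rewrite T0 mul0r.
Qed.

(** Pointwise convergence in [h] with bounded traces is enough: the trace bound passes to the limit
    by [onb_sum_le_lim]. *)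
Lemma Tspos_lim (A_ : nat -> h -> h) A K : (forall n, Tspos (A_ n)) ->
  (forall n, tnorm (A_ n) <= K) -> (forall x, cvs (fun n => A_ n x) (A x)) ->
  Tspos A /\ tnorm A <= K.
Proof.
move=> tA AK cA.
have sA : selfadjoint A.
  by apply: (selfadjoint_lim form_hilbert) cA => n; have [[]] := (TsposP _).1 (tA n).
have cip x : (fun n => ip (A_ n x) x) @ \oo --> ip (A x) x by exact: cvs_ip.
apply: Tspos_le.
  split => //.
    move=> x; apply: (ler_cvg_to (cvg_cst 0) (cip x)); apply: nearW => n.
    by have [[_ A0 _] _] := (TsposP _).1 (tA n); exact: A0.
  exists K => x; apply: (ler_cvg_to (cvs_nm form_hilbert (cA x)) (cvg_cst (K * nm x))).
  apply: nearW => n; apply: le_trans (Tspos_bound (tA n) x) _.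
  by rewrite ler_wpM2r ?nm_ge0.
apply: (onb_sum_le_lim (f_ := fun n e => ip (A_ n e) e)) => // n.
by rewrite Tspos_tnorm // lee_fin.
Qed.

Lemma Tspos_closed (A_ : nat -> h -> h) A : (forall n, Tspos (A_ n)) -> Ts A ->
  (fun n => tnorm (A_ n - A)) @ \oo --> (0 : R) -> Tspos A.
Proof.
move=> tA ttA cA; have sA := ttA.1; split => //; apply/(positive_op_ip sA) => x.
have cip : (fun n => ip (A_ n x) x) @ \oo --> ip (A x) x.
  apply: cvs_ip => //.
  apply: (@cvs_of_le _ _ _ _ _ (fun n => tnorm (A_ n - A) * nm x)).
    by move=> n; exact: (Ts_bound (TsB (TsposW (tA n)) ttA).1).
  by rewrite -(mul0r (nm x)); apply: cvgM => //; exact: cvg_cst.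
apply: (ler_cvg_to (cvg_cst 0) cip); apply: nearW => n.
by have [[_ A0 _] _] := (TsposP _).1 (tA n); exact: A0.
Qed.

Lemma half_expr_cvg (K : R) : (fun n => K * 2^-1 ^+ n) @ \oo --> (0 : R).
Proof.
rewrite -(mulr0 K); apply: cvgM; first exact: cvg_cst.
by apply: cvg_expr; rewrite ger0_norm // invf_lt1 // ltr1n.
Qed.

(** Partial sums converge pointwise because the trace norm dominates the operator norm. [Tspos_lim],
    applied to differences of partial sums, then gives positivity and size of the tails together. *)
Lemma Tspos_series (a_ : nat -> h -> h) : (forall n, Tspos (a_ n)) ->
  (forall n, tnorm (a_ n) <= 2^-1 ^+ n) ->
  exists a, Tspos a /\ forall n, Tspos (a - \sum_(k < n) a_ k) /\
    tnorm (a - \sum_(k < n) a_ k) <= 2 * 2^-1 ^+ n.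
Proof.
move=> ta na; pose S n := \sum_(k < n) a_ k.
have SS m n : Tspos (S (m + n)%N - S m) /\
    tnorm (S (m + n)%N - S m) <= 2 * 2^-1 ^+ m - 2 * 2^-1 ^+ (m + n)%N.
  elim: n => [|n [IH1 IH2]].
    by rewrite addn0 !subrr; exact: Tspos0.
  have -> : S (m + n.+1)%N - S m = (S (m + n)%N - S m) + a_ (m + n)%N.
    by rewrite addnS /S big_ord_recr /= addrAC.
  have [tD nD] := TsposD IH1 (ta (m + n)%N); split => //.
  rewrite nD addnS exprS; have := na (m + n)%N; lra.
have p0 n : 0 <= 2^-1 ^+ n :> R by rewrite exprn_ge0.
have Sb m n : tnorm (S (m + n)%N - S m) <= 2 * 2^-1 ^+ m.
  by apply: le_trans (SS m n).2 _; have := p0 (m + n)%N; lra.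
have /choice[a ca] : forall x, exists y, cvs (fun n => S n x) y.
  move=> x; apply: (hilbert_complete_le form_hilbert (d := fun m => 2 * 2^-1 ^+ m * nm x)).
    move=> m n mn; rewrite -(subnKC mn).
    apply: le_trans (Tspos_bound (SS m (n - m)%N).1 x) _.
    by rewrite ler_wpM2r ?nm_ge0.
  rewrite -(mul0r (nm x)); apply: cvgM; [exact: half_expr_cvg|exact: cvg_cst].
have tail n : Tspos (a - S n) /\ tnorm (a - S n) <= 2 * 2^-1 ^+ n.
  apply: (@Tspos_lim (fun k => S (n + k)%N - S n)) => [k|k|x].
  - exact: (SS n k).1.
  - exact: Sb.
  have cS : cvs (fun k => S (n + k)%N x) (a x).
    have := ca x; rewrite /hcvg -(cvg_shiftn n).
    by under eq_fun do rewrite addnC.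
  by apply: cvsD => //; exact: cvs_cst.
exists a; split => //; have [] := tail 0%N.
by rewrite /S big_ord0 subr0.
Qed.

(** The increments are split by Jordan, and the two resulting positive series are summed separately.
    Each tail costs [2 * 2^-1 ^+ n], hence the 4. *)
Lemma Ts_complete (T_ : nat -> h -> h) : (forall n, Ts (T_ n)) ->
  (forall n, tnorm (T_ n.+1 - T_ n) <= 2^-1 ^+ n) ->
  exists2 T, Ts T & forall n, tnorm (T - T_ n) <= 4 * 2^-1 ^+ n.
Proof.
move=> tT nT.
have /choice[ab abP] : forall n, exists ab : (h -> h) * (h -> h),
    [/\ Tspos ab.1, Tspos ab.2, T_ n.+1 - T_ n = ab.1 - ab.2 &
     tnorm ab.1 + tnorm ab.2 <= 2^-1 ^+ n].
  move=> n; have [a [b [ta tb Tab nab]]] := jordan_decomposition (TsB (tT n.+1) (tT n)).1.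
  exists (a, b); split => //=; first exact/funext.
  by rewrite -nab.
have [||a [ta na]] := @Tspos_series (fun n => (ab n).1).
- by move=> n; have [] := abP n.
- move=> n; have [_ /TsposW/tnorm_ge0 b0 _] := abP n; lra.
have [||b [tb nb]] := @Tspos_series (fun n => (ab n).2).
- by move=> n; have [] := abP n.
- move=> n; have [/TsposW/tnorm_ge0 b0 _ _] := abP n; lra.
pose T := T_ 0%N + (a - b).
have tele n : T_ n = T_ 0%N + (\sum_(k < n) (ab k).1 - \sum_(k < n) (ab k).2).
  elim: n => [|n IH]; first by rewrite !big_ord0 subrr addr0.
  have [_ _ e _] := abP n.
  rewrite !big_ord_recr /= opprD addrACA -e addrA -IH addrC subrK.
  by [].
exists T; first exact: (TsD (tT 0%N) (TsB (TsposW ta) (TsposW tb)).1).1.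
move=> n; have -> : T - T_ n = (a - \sum_(k < n) (ab k).1) - (b - \sum_(k < n) (ab k).2).
  rewrite (tele n) /T.
  move: (T_ 0%N) (\sum_(k < n) (ab k).1) (\sum_(k < n) (ab k).2) => t0 sa sb.
  by apply/funext => x; apply: (@ip_ext _ _ _ form_hilbert) => z; rewrite !fctE !ipE; ring.
have [ta' na'] := na n; have [tb' nb'] := nb n.
have [_] := TsB (TsposW ta') (TsposW tb').
lra.
Qed.

(** * The trace functional and the trace pairing *)

Lemma Psi_sum_over T : Psi form T = sum_over (onb form) (fun e => ip (T e) e).
Proof. by []. Qed.

(** Valid for every splitting into the cone, so additivity of the norm on the cone gives linearity
    of [Psi]. *)
Lemma Psi_diff T a b : Tspos a -> Tspos b -> (forall x, T x = a x - b x) ->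
  Psi form T = tnorm a - tnorm b.
Proof.
move=> ta tb Tab; rewrite Psi_sum_over.
have [[_ a0 _] af] := (TsposP a).1 ta; have [[_ b0 _] bf] := (TsposP b).1 tb.
rewrite [X in sum_over _ X](_ : _ = (fun e => ip (a e) e - ip (b e) e)); last first.
  by apply/funext => e; rewrite Tab ipBl.
by rewrite sum_over_onbB // !Tspos_tnorm.
Qed.

Lemma PsiD S T : Ts S -> Ts T -> Psi form (S + T) = Psi form S + Psi form T.
Proof.
move=> /jordan_decomposition[a [b [ta tb Sab _]]].
move=> /jordan_decomposition[c [d [tc td Tcd _]]].
have [tac eac] := TsposD ta tc; have [tbd ebd] := TsposD tb td.
have STE x : (S + T) x = (a + c) x - (b + d) x.
  by rewrite !fctE Sab Tcd opprD addrACA.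
by rewrite (Psi_diff tac tbd STE) (Psi_diff ta tb Sab) (Psi_diff tc td Tcd) eac ebd; ring.
Qed.

Lemma PsiZ r T : Ts T -> Psi form (rscale r T) = r * Psi form T.
Proof.
move=> /jordan_decomposition[a [b [ta tb Tab _]]]; rewrite (Psi_diff ta tb Tab).
have [tra ea] := Tspos_rscale (normr_ge0 r) ta.
have [trb eb] := Tspos_rscale (normr_ge0 r) tb.
have [r0|r0] := leP 0 r.
  rewrite (Psi_diff tra trb); first by rewrite ea eb ger0_norm //; ring.
  by move=> x; rewrite !rscaleE Tab rsDr rsNr ger0_norm.
rewrite (Psi_diff trb tra); first by rewrite ea eb ltr0_norm //; ring.
by move=> x; rewrite !rscaleE Tab rsDr rsNr ltr0_norm // !rsN opprK addrC.
Qed.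

(* Tr(beta rho) = sum_e <beta s e, s e> with s = sqrt rho: polarize
   Re <s e, s beta e> and use that A and its adjoint have the same
   Hilbert-Schmidt norm. *)
Lemma trace_psd_mul beta rho s : psd_op beta -> Tspos rho -> psd_op s ->
  s \o s = rho ->
  (onb_sum (fun e => ip (beta (s e)) (s e)) < +oo)%E /\
  complex.Re (trace form (beta \o rho)) =
    fine (onb_sum (fun e => ip (beta (s e)) (s e))).
Proof.
move=> [sb b0 [M0 bM0]] trho sp ssr; have [ss _ _] := sp.
have [M M_ge0 bM] := bounded_by_ge0 bM0.
(* Normalized for polarization: the squared norms of [A 1 e] and [A (-1) e] differ by
   [ip (s e) (s (beta e))], those of [A' 1 e] and [A' (-1) e] by [ip (s e) (beta (s e))]. *)
pose A (c : R) x := rs 2^-1 (s x + rs c (s (beta x))).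
pose A' (c : R) x := rs 2^-1 (s x + rs c (beta (s x))).
have AA c : adjoint_pair (A c) (A' c).
  apply: (adjoint_pair_rs (A := fun x => s x + rs c (s (beta x)))
    (A' := fun x => s x + rs c (beta (s x))) _).
  apply: adjoint_pairD => //; apply: (adjoint_pair_rs (A := s \o beta) (A' := beta \o s) _).
  exact: adjoint_pair_comp.
have hss : hs s = (tnorm rho)%:E by rewrite (hs_sqrt sp ssr) Tspos_tnorm.
pose C (c : R) : R := `|2^-1| * (1 + `|c| * M).
have hA' c : (hs (A' c) <= (C c ^+ 2 * tnorm rho)%:E)%E.
  apply: (@onb_sum_leM _ (fun e => ip (s e) (s e))); last by rewrite -hss.
  - exact: sqr_ge0.
  - by move=> e; exact: ip_ge0.
  move=> e; rewrite -!(nm_sqr form_hilbert) -exprMn ler_sqr ?nnegrE ?nm_ge0 //; last first.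
    by rewrite mulr_ge0 ?nm_ge0 // mulr_ge0 // addr_ge0 // mulr_ge0.
  rewrite /A' nmZ -mulrA ler_wpM2l // mulrDl mul1r.
  apply: le_trans (nmD form_hilbert _ _) _; rewrite lerD2l nmZ -mulrA.
  by rewrite ler_wpM2l.
have fA' c : (hs (A' c) < +oo)%E by exact: le_lt_trans (hA' c) (ltry _).
have fA c : (hs (A c) < +oo)%E by rewrite (hs_adjoint (AA c)).
have g0 : forall e, 0 <= ip (beta (s e)) (s e) by [].
have gf : (onb_sum (fun e => ip (beta (s e)) (s e)) < +oo)%E.
  apply: le_lt_trans (ltry (M * tnorm rho)).
  apply: (@onb_sum_leM _ (fun e => ip (s e) (s e))) => //; last by rewrite -hss.
  - by move=> e; exact: ip_ge0.
  move=> e; apply: le_trans (ler_norm _) _.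
  apply: le_trans (cauchy_schwarz form_hilbert _ _) _.
  by rewrite -nm_sqr // expr2 mulrA ler_wpM2r ?nm_ge0.
split => //.
have -> : complex.Re (trace form (beta \o rho)) =
    sum_over (onb form) (fun e => ip (beta (rho e)) e) by [].
have ipp B e : 0 <= ip (B e) (B e) by exact: ip_ge0.
have -> : sum_over (onb form) (fun e => ip (beta (rho e)) e) =
    fine (hs (A 1)) - fine (hs (A (-1))).
  rewrite -(sum_over_onbB (ipp (A 1)) (ipp (A (-1))) (fA _) (fA _)).
  congr sum_over; apply/funext => e; rewrite (adj_ip sb) -ssr /= (adj_ip ss) /A !ipE.
  by rewrite (ipC form (s (beta e)) (s e)); field.
rewrite !(hs_adjoint (AA _)).
rewrite -(sum_over_onbB (ipp (A' 1)) (ipp (A' (-1))) (fA' _) (fA' _)).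
(* Subtracting the zero family makes the nonnegative sum an instance of [sum_over_onbB]. *)
have z0 : onb_sum (fun=> 0) = 0%E by rewrite /onb_sum esum1.
have zf : (onb_sum (fun=> 0%R) < +oo)%E by rewrite z0 ltry.
have := sum_over_onbB g0 (fun=> lexx 0) gf zf; rewrite z0 /= subr0 => <-.
congr sum_over; apply/funext => e.
by rewrite /A' !ipE subr0 (ipC form (s e) (beta (s e))); field.
Qed.

Lemma trace_psd_mul_bound beta : psd_op beta -> exists2 M, 0 <= M &
  forall rho, Tspos rho ->
    0 <= complex.Re (trace form (beta \o rho)) <= M * tnorm rho.
Proof.
move=> bp; have [sb b0 [M0 bM0]] := bp.
have [M M_ge0 bM] := bounded_by_ge0 bM0; exists M => // rho trho.
have [rp _] := (TsposP rho).1 trho.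
have [s [sp ssr _]] := psd_sqrt_exists form_hilbert rp.
have [gf ->] := trace_psd_mul bp trho sp ssr.
rewrite fine_ge0 ?onb_sum_ge0 //= -lee_fin onb_sum_fineK //.
apply: (@onb_sum_leM _ (fun e => ip (s e) (s e))) => //.
- by move=> e; exact: ip_ge0.
- move=> e; apply: le_trans (ler_norm _) _.
  apply: le_trans (cauchy_schwarz form_hilbert _ _) _.
  by rewrite -nm_sqr // expr2 mulrA ler_wpM2r ?nm_ge0.
- by rewrite -/(hs s) (hs_sqrt sp ssr) Tspos_tnorm.
Qed.

(** If the trace vanishes, [beta (s e) = 0] on the basis, for [s] the square root of [rho]. By
    self-adjointness [s (beta y)] is then orthogonal to the basis, so it is zero for every [y], and
    taking adjoints again gives [beta (s (s x)) = 0]. *)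
Lemma trace_psd_mul_eq0 beta rho : psd_op beta -> Tspos rho ->
  complex.Re (trace form (beta \o rho)) = 0 <-> forall x, beta (rho x) = 0.
Proof.
move=> bp trho; have [sb b0 _] := bp; split=> [tr0 x|br0]; last first.
  have -> : beta \o rho = fun=> 0 by apply/funext => x /=; exact: br0.
  rewrite -[LHS]/(Psi form 0); have := PsiZ 0 Ts0; rewrite mul0r.
  by rewrite (_ : rscale 0 0 = 0) //; apply/funext => x; rewrite rscaleE rs0.
have [rp _] := (TsposP rho).1 trho.
have [s [sp ssr _]] := psd_sqrt_exists form_hilbert rp; have [ss _ _] := sp.
have [gf trE] := trace_psd_mul bp trho sp ssr.
have bs0 e : onb form e -> beta (s e) = 0.
  move=> Ee; apply: (positive_eq0 form_hilbert sb b0).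
  apply: (@onb_sum0 (fun e => ip (beta (s e)) (s e))) Ee => //.
  by rewrite -onb_sum_fineK // -trE tr0.
have sb0 y : s (beta y) = 0.
  have [_] := onbP form_hilbert; apply => e Ee.
  by rewrite ss sb bs0 // linear0r.
have -> : beta (rho x) = beta (s (s x)) by rewrite -ssr.
apply: form_ext => // z; rewrite form0l //.
by rewrite sb ss sb0 linear0r.
Qed.

Lemma rank_one_Tspos x : Tspos (fun y => form y x *: x).
Proof.
have s1 : selfadjoint (fun y => form y x *: x).
  move=> y z; rewrite formZl linearZr_LR /= (formC form z x) mulrC.
  by congr (_ * _); rewrite -[RHS]/((form z x)^*)%C formC conjcK.
have ipE1 y : ip (form y x *: x) y = csq (form y x).
  have := ip_ge0 form_hilbert y; rewrite /inner formZl (formC form y x) -csqE //.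
have p1 : psd_op (fun y => form y x *: x).
  split => //; first by move=> y; rewrite ipE1 csq_ge0.
  exists (ip x x) => y; rewrite (nm_scale form_hilbert).
  rewrite -(nm_sqr form_hilbert x) mulrC expr2 -mulrA ler_wpM2l ?nm_ge0 //.
  rewrite -[leRHS]ger0_norm ?mulr_ge0 ?nm_ge0 // -sqrtr_sqr ler_sqrt ?sqr_ge0 //.
  by rewrite exprMn !nm_sqr // mulrC csq_form_le.
apply: (Tspos_le (K := ip x x) p1 _).1.
rewrite -(parseval form_hilbert (onbP form_hilbert)).
by apply: le_esum => e _; rewrite lee_fin ipE1 formC csqJ.
Qed.

End HilbertSchmidt.

(** * The Banach space of trace class operators *)

Section BanachSpaceOfOperators.
Context {R : realType} {h : completeNormedModType R[i]}.
Variable form : {dot h for Num.conj}.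

(* The hypothesis is a parameter of the type because the norm axioms depend on it. *)
Record ts_op (form_hilbert : hilbert_form form) :=
  TsOp { ts_val : h -> h ; ts_valP : Ts form ts_val }.

Variable form_hilbert : hilbert_form form.
Local Notation X := (ts_op form_hilbert).
Implicit Types (u v w : X) (r s : R).

Lemma ts_val_inj : injective (@ts_val form_hilbert).
Proof.
by move=> [u uP] [v vP] /= uv; subst v; congr (TsOp form_hilbert); exact: Prop_irrelevance.
Qed.

HB.instance Definition _ := gen_eqMixin X.
HB.instance Definition _ := gen_choiceMixin X.

Definition ts_zero : X := TsOp form_hilbert (Ts0 form_hilbert).
Definition ts_add u v : X := TsOp form_hilbert (TsD form_hilbert (ts_valP u) (ts_valP v)).1.
Definition ts_opp u : X := TsOp form_hilbert (TsN form_hilbert (ts_valP u)).1.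
Definition ts_scale r u : X := TsOp form_hilbert (Ts_rscale form_hilbert r (ts_valP u)).1.

Lemma ts_addA : associative ts_add.
Proof. by move=> u v w; apply: ts_val_inj; exact: addrA. Qed.
Lemma ts_addC : commutative ts_add.
Proof. by move=> u v; apply: ts_val_inj; exact: addrC. Qed.
Lemma ts_add0 : left_id ts_zero ts_add.
Proof. by move=> u; apply: ts_val_inj; exact: add0r. Qed.
Lemma ts_addN : left_inverse ts_zero ts_opp ts_add.
Proof. by move=> u; apply: ts_val_inj; exact: addNr. Qed.

HB.instance Definition _ := GRing.isZmodule.Build X ts_addA ts_addC ts_add0 ts_addN.

Lemma ts_scaleA r s u : ts_scale r (ts_scale s u) = ts_scale (r * s) u.
Proof. by apply: ts_val_inj; apply/funext => x; exact: rsA. Qed.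
Lemma ts_scale1 : left_id 1 ts_scale.
Proof. by move=> u; apply: ts_val_inj; apply/funext => x; exact: rs1. Qed.
Lemma ts_scaleDr : right_distributive ts_scale +%R.
Proof. by move=> r u v; apply: ts_val_inj; apply/funext => x; exact: rsDr. Qed.
Lemma ts_scaleDl u : {morph ts_scale^~ u : r s / r + s}.
Proof. by move=> r s; apply: ts_val_inj; apply/funext => x; exact: rsD. Qed.

HB.instance Definition _ := GRing.Zmodule_isLmodule.Build R X
  ts_scaleA ts_scale1 ts_scaleDr ts_scaleDl.

Definition ts_norm u : R := tnorm form (ts_val u).

Lemma ts_normD u v : ts_norm (u + v) <= ts_norm u + ts_norm v.
Proof. exact: (TsD form_hilbert (ts_valP u) (ts_valP v)).2. Qed.
Lemma ts_normZ r u : ts_norm (r *: u) = `|r| * ts_norm u.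
Proof. exact: (tnorm_rscale form_hilbert r (ts_valP u)). Qed.
Lemma ts_norm_eq0 u : ts_norm u = 0 -> u = 0.
Proof. by move=> u0; apply: ts_val_inj; exact: (tnorm_eq0 form_hilbert (ts_valP u)). Qed.

HB.instance Definition _ := Lmodule_isNormed.Build R X ts_normD ts_normZ ts_norm_eq0.

Lemma ts_normE u : `|u| = tnorm form (ts_val u). Proof. by []. Qed.
Lemma ts_valD u v : ts_val (u + v) = ts_val u + ts_val v. Proof. by []. Qed.
Lemma ts_valB u v : ts_val (u - v) = ts_val u - ts_val v. Proof. by []. Qed.
Lemma ts_valZ r u : ts_val (r *: u) = rscale r (ts_val u). Proof. by []. Qed.

Lemma ts_cauchy_cvg (F : set_system X) : ProperFilter F -> cauchy F -> cvg F.
Proof.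
move=> FF Fc; have cF := (cauchyP F).1 Fc.
have p0 n : 0 < (2^-1 ^+ n.+2 : R) by rewrite exprn_gt0.
(* These radii make consecutive centres close: the two balls meet, and
   [2^-(n+2) + 2^-(n+3) <= 2^-n]. *)
have /choice[u uF] : forall n, exists u, F (ball u (2^-1 ^+ n.+2)) by move=> n; exact: cF.
have [||T tT nT] := @Ts_complete _ _ _ form_hilbert (fun n => ts_val (u n)).
- by move=> n; exact: ts_valP.
- move=> n; rewrite -ts_valB -ts_normE.
  have [w []] := filter_ex (filterI (uF n) (uF n.+1)).
  rewrite -!ball_normE /= => h1 h2.
  rewrite -(subrK w (u n.+1)) -addrA; apply: le_trans (ler_normD _ _) _.
  rewrite (distrC w).
  have := p0 n; rewrite !exprS in h1 h2 *; lra.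
apply/cvg_ex; exists (TsOp form_hilbert tT); apply/cvgrPdist_le => e e0.
have : (fun n => 4 * 2^-1 ^+ n + 2^-1 ^+ n.+2) @ \oo --> (0 : R).
  rewrite -(addr0 0); apply: cvgD; first exact: half_expr_cvg.
  rewrite [X in X @ _ --> _](_ : _ = (fun n => (2^-1 * 2^-1) * 2^-1 ^+ n)); first exact: half_expr_cvg.
  by apply/funext => n; rewrite !exprS mulrA.
move=> /cvgrPdist_le /(_ _ e0) [n _ /(_ n (leqnn n))].
rewrite sub0r normrN => ne.
near=> w.
have uw : `|u n - w| <= 2^-1 ^+ n.+2.
  by apply: ltW; near: w; have := uF n; rewrite -ball_normE.
rewrite -(subrK (u n) (TsOp form_hilbert tT)) -addrA; apply: le_trans (ler_normD _ _) _.
apply: le_trans ne; apply: le_trans (ler_norm _); apply: lerD => //.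
exact: nT.
Unshelve. all: by end_near. Qed.

HB.instance Definition _ := Uniform_isComplete.Build X ts_cauchy_cvg.

End BanachSpaceOfOperators.

(** * Resolvents of contraction semigroups *)

Section ContractionSemigroups.
Context {R : realType} {E : completeNormedModType R}.
Variable S : R -> E -> E.
Implicit Types (u v w : E) (r s t d e l : R) (C : set E).

Record contraction_semigroup : Prop := {
  sg_linear : forall t, 0 <= t -> linear (S t) ;
  sg_contraction : forall t u, 0 <= t -> `|S t u| <= `|u| ;
  sg_id : forall u, S 0 u = u ;
  sg_add : forall s t u, 0 <= s -> 0 <= t -> S (s + t) u = S s (S t u) ;
  sg_continuous : forall u, S t u @[t --> 0^'+] --> u }.

(** A relation rather than a chosen value: domain and generator are handled together, and uniqueness
    of limits replaces the choice in [gen]. *)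
Definition generator_graph v w := t^-1 *: (S t v - v) @[t --> 0^'+] --> w.

(** Quantifying over such cones lets the resolvent inherit positivity without bringing the operator
    order into the abstract setting. *)
Definition invariant_cone C := [/\ closed C, C 0, forall u v, C u -> C v -> C (u + v),
  forall r u, 0 <= r -> C u -> C (r *: u) &
  forall t u, 0 <= t -> C u -> C (S t u)].

Hypothesis SS : contraction_semigroup.

Lemma generator_graph_unique v w w' :
  generator_graph v w -> generator_graph v w' -> w = w'.
Proof. exact: cvg_unique. Qed.

Lemma sgD t u v : 0 <= t -> S t (u + v) = S t u + S t v.
Proof. by move=> t0; have := sg_linear SS t0 1 u v; rewrite !scale1r. Qed.

Lemma sg0 t : 0 <= t -> S t 0 = 0.
Proof. by move=> t0; apply: (addIr (S t 0)); rewrite -sgD // !add0r. Qed.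

Lemma sgZ t r u : 0 <= t -> S t (r *: u) = r *: S t u.
Proof. by move=> t0; have := sg_linear SS t0 r u 0; rewrite sg0 // !addr0. Qed.

Lemma generator_graph_linear r v w v' w' : generator_graph v w ->
  generator_graph v' w' -> generator_graph (r *: v + v') (r *: w + w').
Proof.
move=> vw vw'; rewrite /generator_graph.
have : (fun t => r *: (t^-1 *: (S t v - v)) + t^-1 *: (S t v' - v')) @ 0^'+ --> r *: w + w'.
  by apply: cvgD => //; apply: cvgZr.
apply: cvg_trans; apply: near_eq_cvg; near=> t.
have t0 : 0 <= t by apply: ltW; near: t; exact: nbhs_right_gt.
rewrite sgD // sgZ // scalerA mulrC -scalerA -scalerDr scalerBr; congr (_ *: _).
by rewrite opprD addrACA.
Unshelve. all: by end_near. Qed.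

Lemma expR_diff_quotient c : t^-1 * (expR (c * t) - 1) @[t --> (0 : R)^'+] --> c.
Proof.
have dc : is_derive (0 : R) (1 : R) ( *%R c) c.
  by have := is_deriveZ c (is_derive_id (0 : R) 1); rewrite /GRing.scale /= mulr1.
have de : is_derive (c * 0) (1 : R) (@expR R) 1.
  by apply: (is_derive_eq (is_derive_expR (c * 0))); rewrite mulr0 expR0.
have [cvgE limE] := is_derive1_comp de dc.
rewrite mul1r in limE; rewrite -{2}limE; apply: cvg_dnbhs_at_right.
move: cvgE; rewrite /derivable /derive.
under eq_fun do rewrite /= !addr0 mulr0 expR0 /GRing.scale /= mulr1.
exact.
Qed.

Section Resolvent.
Variable l : R.
Hypothesis l0 : 0 < l.

(** The semigroup whose generator is that of [S] minus [l]; a strict contraction at positive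
    times. *)
Definition damped t u := expR (- l * t) *: S t u.
Local Notation T := damped.

Lemma damped_bound t u : 0 <= t -> `|T t u| <= expR (- l * t) * `|u|.
Proof.
move=> t0; rewrite /T normrZ ger0_norm ?expR_ge0 // ler_wpM2l ?expR_ge0 //.
exact: sg_contraction.
Qed.

Lemma damped_contraction t u : 0 <= t -> `|T t u| <= `|u|.
Proof.
move=> t0; apply: le_trans (damped_bound u t0) _.
by rewrite ler_piMl // -(expR0 R) ler_expR mulNr oppr_le0 mulr_ge0 // ltW.
Qed.

Lemma dampedD t u v : 0 <= t -> T t (u + v) = T t u + T t v.
Proof. by move=> t0; rewrite /T sgD // scalerDr. Qed.

Lemma dampedZ t r u : 0 <= t -> T t (r *: u) = r *: T t u.
Proof. by move=> t0; rewrite /T sgZ // scalerA mulrC -scalerA. Qed.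

Lemma dampedB t u v : 0 <= t -> T t (u - v) = T t u - T t v.
Proof. by move=> t0; rewrite -scaleN1r dampedD // dampedZ // scaleN1r. Qed.

Lemma damped_add s t u : 0 <= s -> 0 <= t -> T (s + t) u = T s (T t u).
Proof.
move=> s0 t0; rewrite /T sgZ // -sg_add // scalerA -expRD.
by rewrite -mulrDr.
Qed.

Lemma damped_id u : T 0 u = u.
Proof. by rewrite /T mulr0 expR0 scale1r sg_id. Qed.

Lemma damped_continuous u e : 0 < e ->
  exists2 d, 0 < d & forall t, 0 <= t < d -> `|T t u - u| <= e.
Proof.
move=> e0.
have : T t u @[t --> 0^'+] --> u.
  rewrite -[X in _ --> X]scale1r; apply: cvgZ; last exact: sg_continuous.
  apply: cvg_at_right_filter.
  rewrite -[X in _ --> X](expR0 R) -[in X in _ --> X](mulr0 (- l)).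
  apply: continuous_cvg; first exact: continuous_expR.
  by apply: cvgM; [exact: cvg_cst|exact: cvg_id].
move=> /cvgrPdist_le /(_ _ e0) [d /= d0 dP]; exists d => // t /andP[].
rewrite le_eqVlt => /orP[/eqP <- _|t0 td]; first by rewrite damped_id subrr normr0 ltW.
by rewrite distrC; apply: dP => //=; rewrite sub0r normrN gtr0_norm.
Qed.

(** Discrete form of the bound [1 / l] on the resolvent: [expR (- l d) <= 1 / (1 + l d)] bounds
    [w - T d w] from below by [l d / (1 + l d)] times the norm of [w]. *)
Lemma damped_resolvent_bound d w : 0 < d ->
  `|d *: w| <= (1 + l * d) / l * `|w - T d w|.
Proof.
move=> d0; have Tw := damped_bound w (ltW d0).
have ld : 0 < l * d by rewrite mulr_gt0.
have q1 : expR (- l * d) <= (1 + l * d)^-1.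
  rewrite mulNr expRN lef_pV2 ?posrE ?expR_gt0 ?expR_ge1Dx //.
  by rewrite addr_gt0.
have wT : `|w| <= `|w - T d w| + (1 + l * d)^-1 * `|w|.
  rewrite -{1}(subrK (T d w) w); apply: le_trans (ler_normD _ _) _; rewrite lerD2l.
  by apply: le_trans Tw _; rewrite ler_wpM2r.
rewrite normrZ gtr0_norm //.
have p : 0 < 1 + l * d by rewrite addr_gt0.
rewrite mulrAC ler_pdivlMr //.
have := ler_wpM2l (ltW p) wT.
rewrite mulrDr mulrA divff ?gt_eqF // mul1r.
lra.
Qed.

Lemma damped_equation d u : 0 < d -> exists w, w - T d w = u /\
  forall C, invariant_cone C -> C u -> C w.
Proof.
move=> d0.
have fix_in C : closed C -> C u -> (forall w, C w -> C (u + T d w)) -> exists2 w, C w & w - T d w = u.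
  move=> cC Cu Cf.
  pose f : {fun C >-> C} := HB.pack (fun w => u + T d w) (isFun.Build _ _ C C (fun w => u + T d w) Cf).
  have qn : 0 <= expR (- l * d) by exact: expR_ge0.
  have fc : is_contraction f.
    exists (NngNum qn); split => /=; first by rewrite expR_lt1 mulNr oppr_lt0 mulr_gt0.
    move=> [x y] /= _; rewrite opprD addrACA subrr add0r -dampedB; last exact: ltW.
    by apply: damped_bound; exact: ltW.
  have [w Cw wf] := banach_fixed_point fc cC (ex_intro _ u Cu).
  by exists w => //; rewrite {1}wf /f /= addrK.
have [w _ wE] := fix_in setT closedT I (fun _ _ => I).
exists w; split => // C [cC C0 CD CZ CS] Cu.
(* The fixed point taken inside [C] equals the global one by uniqueness, so a single [w] serves
   every cone. *)
have [|w' Cw' wE'] := fix_in C cC Cu.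
  by move=> x Cx; apply: CD => //; apply: CZ; [exact: expR_ge0|apply: CS => //; exact: ltW].
suff -> : w = w' by [].
apply/eqP; rewrite -subr_eq0 -normr_le0.
have := damped_resolvent_bound (w - w') d0.
rewrite dampedB; last exact: ltW.
have -> : w - w' - (T d w - T d w') = (w - T d w) - (w' - T d w').
  by rewrite !opprB addrACA [RHS]addrACA [- w' - _]addrC.
by rewrite wE wE' subrr normr0 mulr0 normrZ gtr0_norm // pmulr_rle0.
Qed.

(** Telescoping: [w - T (k d) w] is the sum of [T (j d) u] over [j < k], and each term is within [e]
    of [u]. *)
Lemma damped_iterate d u w e k : 0 <= d -> w - T d w = u ->
  (forall j : nat, (j < k)%N -> `|T (j%:R * d) u - u| <= e) ->
  `|w - T (k%:R * d) w - k%:R *: u| <= k%:R * e.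
Proof.
move=> d0 wE; elim: k => [|k IH] ju.
  by rewrite !mul0r damped_id scale0r subrr subr0 normr0.
have kd : 0 <= k%:R * d by rewrite mulr_ge0.
have -> : w - T (k.+1%:R * d) w - k.+1%:R *: u =
    (w - T (k%:R * d) w - k%:R *: u) + (T (k%:R * d) u - u).
  have Tu : T (k%:R * d) u = T (k%:R * d) w - T (k%:R * d) (T d w).
    by rewrite -wE dampedB.
  rewrite Tu -natr1 mulrDl mul1r damped_add // scalerDl scale1r opprD !addrA.
  by rewrite [w - T _ w - _]addrAC subrK [w - _ - T _ _]addrAC.
apply: le_trans (ler_normD _ _) _; rewrite -natr1 mulrDl mul1r lerD //.
  by apply: IH => j jk; apply: ju; exact: ltnW.
exact: ju.
Qed.

Lemma dyadic_above t r : 0 <= t -> 0 < r ->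
  exists n k : nat, t < k%:R * 2^-1 ^+ n < t + r.
Proof.
move=> t0 r0.
have : (fun n => 1 * 2^-1 ^+ n) @ \oo --> (0 : R).
  rewrite -(mulr0 1); apply: cvgM; first exact: cvg_cst.
  by apply: cvg_expr; rewrite ger0_norm // invf_lt1 // ltr1n.
move=> /cvgrPdist_lt /(_ _ r0) [n _ /(_ n (leqnn n))].
rewrite sub0r normrN mul1r => nr; exists n.
have p0 : 0 < (2^-1 ^+ n : R) by rewrite exprn_gt0.
rewrite gtr0_norm // in nr.
have q0 : 0 <= t / 2^-1 ^+ n by rewrite divr_ge0 // ltW.
have /andP[k1 k2] := truncn_itv q0.
exists (Num.truncn (t / 2^-1 ^+ n)).+1.
rewrite -ltr_pdivrMr // k2 /= -natr1 mulrDl mul1r.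
rewrite ler_pdivlMr // in k1; lra.
Qed.

(** Formally [v] is the integral of [T t u] over positive [t], and [d n *: w n] is its left Riemann
    sum of mesh [d n], a geometric series. Dyadic meshes are nested, so sums of different mesh can
    be compared at common times. *)
Lemma resolvent_exists u : exists v, [/\ generator_graph v (l *: v - u),
  `|v| <= l^-1 * `|u| & forall C, invariant_cone C -> C u -> C v].
Proof.
pose d n : R := 2^-1 ^+ n.
have d0 n : 0 < d n by rewrite exprn_gt0.
have d1 n : d n <= 1 by rewrite exprn_ile1 // ?invr_ge0 // invf_le1 // ler1n.
have dE m n : (n <= m)%N -> d n = (2 ^ (m - n))%:R * d m.
  move=> nm; rewrite /d -{2}(subnKC nm) exprD natrX mulrCA -exprMn divff ?expr1n ?mulr1 //.
have /choice[w wP] n := @damped_equation (d n) u (d0 n).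
have wE n := (wP n).1.
pose K n := d n *: w n.
(* Bounds the factor [(1 + l * d n) / l] of [damped_resolvent_bound], as [d n <= 1]. *)
pose c := (1 + l) / l.
have c0 : 0 < c by rewrite divr_gt0 // addr_gt0.
have near0 e : 0 < e -> exists2 r, 0 < r & forall t, 0 <= t < r -> `|T t u - u| <= e.
  exact: damped_continuous.
have dcvg : d @ \oo --> (0 : R).
  by apply: cvg_expr; rewrite ger0_norm // invf_lt1 // ltr1n.
have small r : 0 < r -> exists N, forall n, (N <= n)%N -> d n < r.
  move=> r0; move/cvgrPdist_lt : dcvg => /(_ _ r0) [N _ NP]; exists N => n Nn.
  by have := NP n Nn; rewrite /= sub0r normrN gtr0_norm.
(* [k d n] is a multiple of the finer mesh [d m], so [damped_iterate] applies to [w m] at that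
   time. *)
have Kt e r n m k : (forall t, 0 <= t < r -> `|T t u - u| <= e) ->
    (n <= m)%N -> k%:R * d n <= r ->
    `|K m - T (k%:R * d n) (K m) - (k%:R * d n) *: u| <= k%:R * d n * e.
  move=> re nm kr; have tE : k%:R * d n = (k * 2 ^ (m - n))%:R * d m.
    by rewrite (dE m n nm) natrM mulrA.
  rewrite tE /K dampedZ; last by rewrite mulr_ge0 // ltW.
  rewrite [_%:R * d m]mulrC -scalerA -!scalerBr normrZ gtr0_norm // -mulrA ler_wpM2l //.
    exact: ltW.
  rewrite [d m * _]mulrC; apply: damped_iterate => //; first exact: ltW.
  move=> j jk; apply: re; rewrite (mulr_ge0 (ler0n _ _) (ltW (d0 m))) /=.
  by apply: lt_le_trans kr; rewrite tE ltr_pM2r // ltr_nat.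
(* [K n] satisfies the equation at time [d n] exactly and [K m] up to [d n * e]; the resolvent bound
   for their difference cancels [d n]. *)
have Kc e r n m : (forall t, 0 <= t < r -> `|T t u - u| <= e) -> d n <= r ->
    (n <= m)%N -> `|K m - K n| <= c * e.
  move=> re nr nm; have := Kt e r n m 1%N re nm; rewrite mul1r => /(_ nr) h1.
  have e0 : 0 <= e.
    by apply: le_trans (normr_ge0 _) (re 0 _); rewrite lexx /=; exact: lt_le_trans nr.
  have h2 : K n - T (d n) (K n) = d n *: u.
    by rewrite /K dampedZ -?scalerBr ?wE //; exact: ltW.
  have := damped_resolvent_bound (K m - K n) (d0 n).
  rewrite dampedB; last exact: ltW.
  have -> : K m - K n - (T (d n) (K m) - T (d n) (K n)) =
      K m - T (d n) (K m) - (K n - T (d n) (K n)).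
    by rewrite !opprB addrACA [RHS]addrACA [- K n - _]addrC.
  rewrite h2 normrZ gtr0_norm // => h3.
  rewrite -(ler_pM2l (d0 n)); apply: le_trans h3 _.
  apply: (@le_trans _ _ (c * (d n * e))); last by rewrite mulrCA.
  apply: ler_pM => //.
    by rewrite divr_ge0 ?ltW // addr_gt0 // mulr_gt0.
  by rewrite ler_pM2r ?invr_gt0 // lerD2l ler_piMr // ltW.
have cK : cvg (K @ \oo).
  apply/cauchy_cvgP/cauchy_ballP => e e0.
  (* Two distances of at most [e / 3] stay strictly below [e]. *)
  pose e' := e / (3 * c).
  have e'0 : 0 < e' by rewrite divr_gt0 // mulr_gt0.
  have [r r0 re] := near0 e' e'0.
  have [N NP] := small r r0.
  near_simpl; exists ([set n | (N <= n)%N], [set n | (N <= n)%N]).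
    by split; exists N.
  move=> [m n] /= [Nm Nn]; rewrite -ball_normE /=.
  have dN := ltW (NP N (leqnn N)).
  have := Kc _ _ _ _ re dN Nm; have := Kc _ _ _ _ re dN Nn.
  have -> : c * e' = e / 3 by rewrite /e'; field; rewrite gt_eqF.
  have -> : K m - K n = (K m - K N) - (K n - K N) by rewrite opprB addrA subrK.
  have := ler_normB (K m - K N) (K n - K N); lra.
have [v Kv] := (cvg_ex (K @ \oo)).1 cK.
have Tlim t : 0 <= t -> T t (K n) @[n --> \oo] --> T t v.
  move=> t0; apply/subr_cvg0; move/subr_cvg0 : Kv.
  move=> /cvgr0Pnorm_le b0; apply/cvgr0Pnorm_le => e /b0.
  apply: filterS => n; apply: le_trans; rewrite -dampedB //.
  exact: damped_contraction.
have dyad e r n k : (forall t, 0 <= t < r -> `|T t u - u| <= e) -> k%:R * d n <= r ->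
    `|v - T (k%:R * d n) v - (k%:R * d n) *: u| <= k%:R * d n * e.
  move=> re kr.
  have kd0 : 0 <= k%:R * d n by rewrite mulr_ge0 // ltW.
  have cc : `|K m - T (k%:R * d n) (K m) - (k%:R * d n) *: u| @[m --> \oo] -->
     `|v - T (k%:R * d n) v - (k%:R * d n) *: u|.
    apply: cvg_norm; apply: cvgB; last exact: cvg_cst.
    by apply: cvgB => //; exact: Tlim.
  apply: (ler_cvg_to cc (cvg_cst (k%:R * d n * e))).
  by exists n => // m nm; exact: (Kt e r n m k re nm kr).
have real e r t : 0 < e -> (forall t, 0 <= t < r -> `|T t u - u| <= e) -> 0 < t < r ->
    `|v - T t v - t *: u| <= t * e.
  move=> e0 re /andP[t0 tr]; apply/ler_addgt0Pr => q q0.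
  have q2 : 0 < q / 2 by rewrite divr_gt0.
  have [r1 r10 r1P] := damped_continuous v q2.
  pose y := e + `|u|.
  have y0 : 0 < y by rewrite ltr_pwDl.
  (* The three bounds keep [t'] below [r], make [T (t' - t) v] close to [v], and make the terms
     linear in [t' - t] smaller than [q / 2]. *)
  pose r2 := Num.min (r - t) (Num.min r1 (q / 2 / y)).
  have r20 : 0 < r2 by rewrite !lt_min subr_gt0 tr r10 divr_gt0.
  have [n [k /andP[]]] := dyadic_above (ltW t0) r20.
  rewrite -/(d n); set t' := k%:R * d n => tt' t'r.
  have hs : t' - t < r2 by rewrite ltrBlDl.
  move: hs; rewrite !lt_min => /and3P[h1 h2 h3].
  have h4 : `|v - T t' v - t' *: u| <= t' * e.
    by apply: dyad re _; rewrite -/t'; lra.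
  have h5 : `|T t' v - T t v| <= q / 2.
    have -> : T t' v = T t (T (t' - t) v).
      by rewrite -damped_add ?subr_ge0 ?(ltW tt') ?(ltW t0) // addrC subrK.
    rewrite -dampedB ?(ltW t0) //.
    apply: le_trans (damped_contraction _ (ltW t0)) _.
    by apply: r1P; rewrite h2 andbT; apply: ltW; rewrite subr_gt0.
  have h6 : (t' - t) * y < q / 2 by rewrite -ltr_pdivlMr.
  have -> : v - T t v - t *: u = (v - T t' v - t' *: u) + ((T t' v - T t v) + (t' - t) *: u).
    rewrite scalerBl !addrA; congr (_ - _).
    by rewrite [v - T t' v - _]addrAC subrK [RHS]addrAC subrK.
  apply: le_trans (ler_normD _ _) _.
  have := ler_normD (T t' v - T t v) ((t' - t) *: u).
  rewrite normrZ gtr0_norm ?subr_gt0 //.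
  rewrite /y mulrDr in h6; rewrite mulrBl in h6; lra.
exists v; split.
- have Tg : t^-1 *: (T t v - v) @[t --> 0^'+] --> - u.
    apply/cvgrPdist_le => e e0; have [r r0 re] := near0 e e0.
    exists r => // t /= tr t0; rewrite sub0r normrN gtr0_norm // in tr.
    have := real e r t e0 re; rewrite t0 tr => /(_ isT) h1.
    have -> : - u - t^-1 *: (T t v - v) = t^-1 *: (v - T t v - t *: u).
      rewrite [RHS]scalerBr scalerA mulVf ?gt_eqF // scale1r [LHS]addrC; congr (_ - u).
      by rewrite -scalerN opprB.
    rewrite normrZ gtr0_norm ?invr_gt0 // mulrC ler_pdivrMr // mulrC.
    by rewrite mulrC [e * t]mulrC.
  rewrite /generator_graph.
  (* Undoing the damping: the difference quotient of [S] is [expR (l t)] times that of [T], plus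
     that of the exponential times [v]. *)
  have : expR (l * t) *: (t^-1 *: (T t v - v)) + (t^-1 * (expR (l * t) - 1)) *: v @[t --> 0^'+] --> 1 *: (- u) + l *: v.
    apply: cvgD.
      apply: cvgZ => //; apply: cvg_at_right_filter.
      rewrite -[X in _ --> X](expR0 R) -[in X in _ --> X](mulr0 l).
      apply: continuous_cvg; first exact: continuous_expR.
      by apply: cvgM; [exact: cvg_cst|exact: cvg_id].
    by apply: cvgZl; exact: expR_diff_quotient.
  rewrite scale1r addrC; apply: cvg_trans; apply: near_eq_cvg; near=> t.
  rewrite scalerA mulrC -scalerA -scalerA -scalerDr; congr (_ *: _).
  rewrite /T scalerBr scalerA -expRD mulNr subrr expR0 scale1r scalerBl scale1r.
  by rewrite addrA subrK.
- have cc : `|K n| @[n --> \oo] --> `|v| by exact: cvg_norm.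
  have cr : (1 + l * d n) / l * `|u| @[n --> \oo] --> l^-1 * `|u|.
    apply: cvgM; last exact: cvg_cst.
    rewrite -[X in _ --> X]mul1r; apply: cvgM; last exact: cvg_cst.
    rewrite -[X in _ --> X]addr0 -(mulr0 l); apply: cvgD; first exact: cvg_cst.
    by apply: cvgM => //; exact: cvg_cst.
  apply: (ler_cvg_to cc cr); apply: nearW => n.
  by have := damped_resolvent_bound (w n) (d0 n); rewrite wE.
- move=> C Cc Cu; have [cC _ _ CZ _] := Cc.
  apply: (closed_cvg C cC _ v Kv); apply: nearW => n.
  by apply: CZ; [exact: ltW|exact: (wP n).2].
Unshelve. all: by end_near. Qed.

(** The orbit of [v] under the damped semigroup has right derivative 0 at 0, while
    [damped_resolvent_bound] bounds [v] by its difference quotients. *)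
Lemma resolvent_injective v : generator_graph v (l *: v) -> v = 0.
Proof.
move=> gv; apply/eqP; rewrite -normr_le0.
have Tg : t^-1 *: (T t v - v) @[t --> 0^'+] --> (0 : E).
  have : expR (- l * t) *: (t^-1 *: (S t v - v)) + (t^-1 * (expR (- l * t) - 1)) *: v @[t --> 0^'+] --> 1 *: (l *: v) + (- l) *: v.
    apply: cvgD.
      apply: cvgZ => //; apply: cvg_at_right_filter.
      rewrite -[X in _ --> X](expR0 R) -[in X in _ --> X](mulr0 (- l)).
      apply: continuous_cvg; first exact: continuous_expR.
      by apply: cvgM; [exact: cvg_cst|exact: cvg_id].
    by apply: cvgZl; exact: expR_diff_quotient.
  rewrite scale1r -scalerDl subrr scale0r; apply: cvg_trans; apply: near_eq_cvg; near=> t.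
  rewrite scalerA mulrC -scalerA -scalerA -scalerDr; congr (_ *: _).
  by rewrite scalerBr scalerBl scale1r addrA subrK.
have c1 : (1 + l * t) / l * `|t^-1 *: (T t v - v)| @[t --> 0^'+] --> (1 + l * 0) / l * `|(0 : E)|.
  apply: cvgM; last exact: cvg_norm.
  apply: cvgM; last exact: cvg_cst.
  apply: cvgD; first exact: cvg_cst.
  apply: cvgM; first exact: cvg_cst.
  by apply: cvg_at_right_filter; exact: cvg_id.
rewrite normr0 mulr0 in c1.
apply: (ler_cvg_to (cvg_cst `|v|) c1); near=> t.
have t0 : 0 < t by near: t; exact: nbhs_right_gt.
have h1 := damped_resolvent_bound v t0; rewrite normrZ gtr0_norm // distrC in h1.
by rewrite normrZ [`|t^-1|]gtr0_norm ?invr_gt0 // mulrCA ler_pdivlMl.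
Unshelve. all: by end_near. Qed.

End Resolvent.
End ContractionSemigroups.

(** * Resolvent families of functionals *)

(* A resolvent family of positive functionals X l = F o Res l either vanishes at
   a point of the cone for all l or for none.  Downwards in l this uses the
   expansion of Res l in powers of Res m. *)
Section ResolventFunctionals.
Context {R : realType} {T : Type}.
Variables (P : T -> Prop) (N : T -> R) (Res : R -> T -> T) (X : R -> T -> R).
Implicit Types (l m : R) (u : T).
Hypothesis Res_P : forall l u, 0 < l -> P u -> P (Res l u).
Hypothesis Res_N : forall l u, 0 < l -> P u -> N (Res l u) <= l^-1 * N u.
Hypothesis X_ge0 : forall l u, 0 < l -> P u -> 0 <= X l u.
Hypothesis X_bound : forall l, 0 < l ->
  exists2 M, 0 <= M & forall u, P u -> X l u <= M * N u.
Hypothesis X_resolvent : forall l m u, 0 < l -> 0 < m -> P u ->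
  X l u = X m u + (m - l) * X m (Res l u).

Lemma resolvent_functional_mono l m u : 0 < l -> l <= m -> P u -> X m u <= X l u.
Proof.
move=> l0 lm Pu; have m0 := lt_le_trans l0 lm.
by rewrite (X_resolvent l0 m0 Pu) lerDl mulr_ge0 ?subr_ge0 // X_ge0 //; exact: Res_P.
Qed.

(** At equal parameters the identity has factor 0, so it is used with [m' > m]: there [X m u = 0] is
    a sum of nonnegative terms, whence [X m' (Res m u) = 0]. A second use bounds [X m (Res m u)] by
    [(m' - m) K], through monotonicity, and [m'] may be taken arbitrarily close to [m]. *)
Lemma resolvent_functional_iter m u : 0 < m -> P u -> X m u = 0 -> X m (Res m u) = 0.
Proof.
move=> m0 Pu Xu; have PRu := Res_P m0 Pu; have PRRu := Res_P m0 PRu.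
have XR m' : m < m' -> X m' (Res m u) = 0.
  move=> mm'; have m'0 := lt_trans m0 mm'.
  have := X_resolvent m0 m'0 Pu; rewrite Xu => /esym/eqP.
  rewrite paddr_eq0 ?X_ge0 //; last by rewrite mulr_ge0 ?X_ge0 // subr_ge0 ltW.
  by move=> /andP[_]; rewrite mulf_eq0 subr_eq0 gt_eqF //= => /eqP.
apply/eqP; rewrite eq_le X_ge0 // andbT; apply/ler_addgt0Pr => e e0; rewrite add0r.
pose K := X m (Res m (Res m u)).
have K0 : 0 <= K by exact: X_ge0.
have K1 : 0 < K + 1 by rewrite ltr_wpDl.
have d0 : 0 < e / (K + 1) by rewrite divr_gt0.
pose m' := m + e / (K + 1).
have mm' : m < m' by rewrite ltrDl.
have m'0 := lt_trans m0 mm'.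
rewrite (X_resolvent m0 m'0 PRu) XR // add0r /m' addrAC subrr add0r.
apply: (@le_trans _ _ (e / (K + 1) * K)).
  by rewrite ler_wpM2l ?(ltW d0) // resolvent_functional_mono // ltW.
by rewrite -mulrA ler_piMr ?ltW // mulrC ltr_pdivrMr // mul1r ltrDl.
Qed.

(** For [l < m] only the remainder of the expansion survives: [X l u = (m - l) ^+ n * X l (w n)], at
    most a constant times [((m - l) / m) ^+ n]. *)
Lemma resolvent_functional_eq0 l m u : 0 < l -> 0 < m -> P u -> X m u = 0 -> X l u = 0.
Proof.
move=> l0 m0 Pu Xu; apply/eqP; rewrite eq_le X_ge0 // andbT.
have [ml|lm] := leP m l; first by rewrite -Xu resolvent_functional_mono.
pose w n := iter n (Res m) u.
have wP n : P (w n) /\ X m (w n) = 0.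
  by elim: n => [//|n [Pn Xn]]; split; [exact: Res_P|exact: resolvent_functional_iter].
have XE n : X l u = (m - l) ^+ n * X l (w n).
  elim: n => [|n IH]; first by rewrite mul1r.
  have [Pn Xn] := wP n.
  have := X_resolvent m0 l0 Pn; rewrite Xn IH exprSr => XS.
  by rewrite -mulrA; congr (_ * _); rewrite [w n.+1]/= -/(w n); lra.
have wN n : N (w n) <= m^-1 ^+ n * N u.
  elim: n => [|n IH]; first by rewrite mul1r.
  apply: le_trans (Res_N m0 (wP n).1) _.
  by rewrite exprS -mulrA ler_wpM2l // invr_ge0 ltW.
have [M M0 XM] := X_bound l0.
have q0 : 0 <= (m - l) / m by rewrite divr_ge0 ?subr_ge0 // ltW.
have c : (fun n => M * N u * ((m - l) / m) ^+ n) @ \oo --> (0 : R).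
  rewrite -(mulr0 (M * N u)); apply: cvgM; first exact: cvg_cst.
  by apply: cvg_expr; rewrite ger0_norm // ltr_pdivrMr // mul1r ltrBlDr ltrDl.
apply: (ler_cvg_to (cvg_cst (X l u)) c); apply: nearW => n.
rewrite (XE n) exprMn mulrCA.
rewrite ler_wpM2l //; first by rewrite exprn_ge0 // subr_ge0 ltW.
apply: le_trans (XM _ (wP n).1) _.
by rewrite -mulrA ler_wpM2l // mulrC wN.
Qed.

End ResolventFunctionals.

(** * Substochastic semigroups *)

Section SubstochasticSemigroups.
Context {R : realType} {h : completeNormedModType R[i]}.
Variable form : {dot h for Num.conj}.
Hypothesis form_hilbert : hilbert_form form.
Local Notation op := (h -> h).
Local Notation X := (ts_op form_hilbert).
Local Notation val := (@ts_val _ _ _ form_hilbert).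
Implicit Types (u v w : X) (l m r t : R).

Lemma Tspos_closed_set : closed [set u : X | Tspos form (val u)].
Proof.
move=> u clu.
have /choice[a aP] : forall n : nat, exists a : X, Tspos form (val a) /\ `|a - u| <= 2^-1 ^+ n.
  move=> n; have p0 : 0 < (2^-1 ^+ n : R) by rewrite exprn_gt0.
  have [a [ta]] := clu _ (nbhsx_ballx u _ p0).
  rewrite -ball_normE /= => /ltW ua; exists a; split => //.
  by rewrite distrC.
apply: (Tspos_closed form_hilbert (fun n => (aP n).1) (ts_valP u)).
apply: (@squeeze_cvgr _ _ _ _ (cst 0) (fun n => 1 * 2^-1 ^+ n)).
- apply: nearW => n; rewrite mul1r -ts_valB -ts_normE normr_ge0; exact: (aP n).2.
- exact: cvg_cst.
- exact: half_expr_cvg.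
Qed.

Variable V : R -> op -> op.
Hypothesis V_substochastic : substochastic form V.

Let V_semigroup : C0_semigroup form V.
Proof. by case: V_substochastic. Qed.

Let V_pos t a : 0 <= t -> Tspos form a -> Tspos form (V t a).
Proof.
by move=> t0 ta; case: V_substochastic => _ Vp _; apply: Vp => //; exact: TsposW.
Qed.

(* Negative times are folded back, so as to get a total family on X. *)
Definition ts_semigroup t u : X :=
  TsOp form_hilbert (C0_maps V_semigroup (normr_ge0 t) (ts_valP u)).
Local Notation S := ts_semigroup.

Lemma ts_semigroupE t u : 0 <= t -> val (S t u) = V t (val u).
Proof. by move=> t0; rewrite /= ger0_norm. Qed.

Lemma ts_semigroup_linear t : 0 <= t -> linear (S t).
Proof.
move=> t0 r u v; apply: ts_val_inj; rewrite ts_semigroupE //.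
rewrite !ts_valD !ts_valZ !ts_semigroupE //.
exact: (C0_linear V_semigroup t0 r (ts_valP u) (ts_valP v)).
Qed.

(** Substochasticity bounds the norm only on the cone. In the Jordan decomposition the norms of the
    parts add up to that of [u], which extends the bound to the whole space. *)
Lemma ts_semigroup_contraction t u : 0 <= t -> `|S t u| <= `|u|.
Proof.
move=> t0.
have [a [b [ta tb uab nu]]] := jordan_decomposition form_hilbert (ts_valP u).
pose a' := TsOp form_hilbert (TsposW ta); pose b' := TsOp form_hilbert (TsposW tb).
have -> : u = (-1) *: b' + a'.
  apply: ts_val_inj; apply/funext => x; rewrite uab ts_valD ts_valZ /= fctE.
  by rewrite rscaleE rsN rs1 addrC.
rewrite ts_semigroup_linear //; apply: le_trans (ler_normD _ _) _.
rewrite normrZ normrN normr1 mul1r !ts_normE !ts_semigroupE //.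
have [_ _ Vc] := V_substochastic.
apply: (@le_trans _ _ (tnorm form b + tnorm form a)).
  by apply: lerD; exact: Vc.
have -> : val ((-1) *: b' + a') = val u.
  apply/funext => x; rewrite uab ts_valD ts_valZ /= fctE.
  by rewrite rscaleE rsN rs1 addrC.
by rewrite nu addrC.
Qed.

Lemma ts_contraction_semigroup : contraction_semigroup S.
Proof.
split.
- exact: ts_semigroup_linear.
- exact: ts_semigroup_contraction.
- move=> u; apply: ts_val_inj; rewrite ts_semigroupE //.
  exact: (C0_id V_semigroup (ts_valP u)).
- move=> s t u s0 t0; apply: ts_val_inj; rewrite !ts_semigroupE ?addr_ge0 //.
  exact: (C0_add V_semigroup s0 t0 (ts_valP u)).
- move=> u; apply/subr_cvg0/norm_cvg0P.
  apply: cvg_trans (C0_continuous V_semigroup (ts_valP u)).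
  apply: near_eq_cvg; near=> t.
  have t0 : 0 <= t by apply: ltW; near: t; exact: nbhs_right_gt.
  by rewrite ts_normE ts_valB ts_semigroupE.
Unshelve. all: by end_near. Qed.
Local Notation SS := ts_contraction_semigroup.

Lemma Tspos_invariant_cone : invariant_cone S [set u : X | Tspos form (val u)].
Proof.
split.
- exact: Tspos_closed_set.
- exact: (Tspos0 form_hilbert).1.
- by move=> u v tu tv; exact: (TsposD form_hilbert tu tv).1.
- by move=> r u r0 tu; exact: (Tspos_rscale form_hilbert r0 tu).1.
- move=> t u t0 tu; change (Tspos form (val (S t u))).
  by rewrite ts_semigroupE //; exact: V_pos.
Qed.

Lemma generator_graphE v w : generator_graph S v w <-> gen_graph form V (val v) (val w).
Proof.
have nE : \forall t \near (0 : R)^'+, `|t^-1 *: (S t v - v) - w| =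
    tnorm form (rscale t^-1 (V t (val v) - val v) - val w).
  near=> t; have t0 : 0 <= t by apply: ltW; near: t; exact: nbhs_right_gt.
  by rewrite ts_normE ts_valB ts_valZ ts_valB ts_semigroupE.
split=> [vw|[_ _ vw]].
  split; [exact: ts_valP|exact: ts_valP|].
  move/subr_cvg0/norm_cvg0P : vw => vw; apply: cvg_trans vw.
  by apply: near_eq_cvg; apply: filterS nE.
apply/subr_cvg0/norm_cvg0P; apply: cvg_trans vw.
by apply: near_eq_cvg; apply: filterS nE => t ->.
Unshelve. all: by end_near. Qed.

Lemma genE v w : generator_graph S v w -> gen form V (val v) = val w.
Proof.
move=> vw; have vw' := (generator_graphE v w).1 vw.
have := @getPex _ [set a | gen_graph form V (val v) a] (ex_intro _ _ vw').
rewrite -/(gen form V (val v)) /=; move: (gen form V (val v)) => a va.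
have [_ ta _] := va; have := (generator_graphE v (TsOp form_hilbert ta)).2 va.
by move=> /(generator_graph_unique vw) ->.
Qed.

Lemma gen_domE v w : generator_graph S v w -> gen_dom form V (val v).
Proof. by move=> /generator_graphE vw; exists (val w). Qed.

Lemma gen_dom_graph a : gen_dom form V a -> exists v w, val v = a /\ generator_graph S v w.
Proof.
move=> [b ab]; have [ta tb _] := ab.
exists (TsOp form_hilbert ta), (TsOp form_hilbert tb); split => //.
exact/generator_graphE.
Qed.

(** The chosen value solves the resolvent equation, and two solutions differ by a vector to which
    [resolvent_injective] applies. *)
Lemma resolventE l u v : 0 < l -> generator_graph S v (l *: v - u) ->
  resolvent (gen_dom form V) (gen form V) l (val u) = val v.
Proof.
move=> l0 vg.
have /= := @getPex _ [set a | gen_dom form V a /\ rscale l a - gen form V a = val u].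
rewrite -/(resolvent (gen_dom form V) (gen form V) l (val u)).
move=> [|/gen_dom_graph[v' [w' [<- v'g]]] e].
  exists (val v); split; first exact: gen_domE vg.
  by rewrite (genE vg) -ts_valZ -ts_valB opprB addrC subrK.
have w'E : w' = l *: v' - u.
  apply: ts_val_inj; rewrite ts_valB ts_valZ -e (genE v'g) opprB addrC subrK.
  by [].
rewrite w'E in v'g.
congr val; apply/eqP; rewrite -subr_eq0; apply/eqP.
apply: (resolvent_injective SS l0).
have := generator_graph_linear (r := -1) SS vg v'g.
have -> : -1 *: v + v' = v' - v by rewrite scaleN1r addrC.
suff -> : -1 *: (l *: v - u) + (l *: v' - u) = l *: (v' - v) by [].
by rewrite scaleN1r opprB scalerBr addrC addrA subrK.
Qed.

Section ResolventFunctional.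
Variable abar : op -> R.
Hypothesis abar_linear : linear_functional_on (gen_dom form V) abar.
Variable beta : R -> op.
Hypothesis betaP : forall l, 0 < l -> represents_Xi form V abar l (beta l).

Lemma Xi_eq0_indep l m (rho : op) : 0 < l -> 0 < m -> Tspos form rho ->
  Xi form V abar m rho = 0 -> Xi form V abar l rho = 0.
Proof.
move=> l0 m0 trho.
(* A total family is chosen; at nonpositive parameters its value 0 is a dummy. *)
have /choice[Res' ResP'] : forall lu : R * X, exists v, 0 < lu.1 ->
    [/\ generator_graph S v (lu.1 *: v - lu.2), `|v| <= lu.1^-1 * `|lu.2| &
     forall C, invariant_cone S C -> C lu.2 -> C v].
  move=> [k u] /=; have [k0|_] := ltP 0 k; last by exists 0.
  by have [v vP] := resolvent_exists SS k0 u; exists v.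
pose Res k u := Res' (k, u).
have ResP k u : 0 < k -> [/\ generator_graph S (Res k u) (k *: Res k u - u),
    `|Res k u| <= k^-1 * `|u| & forall C, invariant_cone S C -> C u -> C (Res k u)].
  by move=> k0; exact: (ResP' (k, u)).
pose F v := a0 form V (val v) - abar (val v).
have XiE k u : 0 < k -> Xi form V abar k (val u) = F (Res k u).
  by move=> k0; have [g _ _] := ResP k u k0; rewrite /Xi (resolventE k0 g).
have F_linear r v w v' w' : generator_graph S v w -> generator_graph S v' w' ->
    F (r *: v + v') = r * F v + F v'.
  move=> vw vw'; have g := generator_graph_linear (r := r) SS vw vw'.
  rewrite /F /a0 (genE g) (genE vw) (genE vw') ts_valD ts_valZ.
  rewrite (PsiD form_hilbert); [|exact: (Ts_rscale form_hilbert r (ts_valP w)).1|exact: ts_valP].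
  rewrite (PsiZ form_hilbert r (ts_valP w)) ts_valD ts_valZ.
  by rewrite (abar_linear r (gen_domE vw) (gen_domE vw')); ring.
have beta_psd k : 0 < k -> psd_op form (beta k).
  by move=> /betaP[bb _ b0 _]; exact/(psd_opP form_hilbert).
(* Representation by [beta k] makes [F (Res k u)] nonnegative, and bounded by a multiple of the
   norm, on the cone. *)
have XiRe k u : 0 < k -> Tspos form (val u) ->
    F (Res k u) = complex.Re (trace form (beta k \o val u)).
  by move=> k0 tu; have [_ _ _ bX] := betaP k0; rewrite -XiE // -bX.
pose P u := Tspos form (val u).
have Pu : P (TsOp form_hilbert (TsposW trho)) by [].
move=> Xm; have := @resolvent_functional_eq0 R X P (fun u => `|u|) Res (fun k u => F (Res k u)).
move=> /(_ _ _ _ _ _ l m _ l0 m0 Pu) H.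
rewrite -[rho]/(val (TsOp form_hilbert (TsposW trho))) XiE //; apply: H.
- move=> k u k0 tu; have [_ _] := ResP k u k0; apply => //.
  exact: Tspos_invariant_cone.
- by move=> k u k0 tu; have [] := ResP k u k0.
- move=> k u k0 tu; rewrite XiRe //.
  have [M _ MP] := trace_psd_mul_bound form_hilbert (beta_psd k k0).
  by have /andP[] := MP _ tu.
- move=> k k0; have [M M0 MP] := trace_psd_mul_bound form_hilbert (beta_psd k k0).
  by exists M => // u tu; rewrite XiRe //; have /andP[] := MP _ tu.
(* Resolvent identity: the difference of its two sides is an eigenvector for [k'], hence zero by
   injectivity; linearity of [F] on the domain transports it to the functionals. *)
- move=> k k' u k0 k'0 tu.
  have [g1 _ _] := ResP k u k0; have [g2 _ _] := ResP k' u k'0.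
  have [g3 _ _] := ResP k' (Res k u) k'0.
  rewrite addrC -(F_linear _ _ _ _ _ g3 g2); congr F.
  have g4 := generator_graph_linear (r := k' - k) SS g3 g2.
  set R1 := Res k u; set R2 := Res k' u; set R3 := Res k' (Res k u).
  rewrite -/R1 in g1; rewrite -/R1 -/R2 -/R3 in g4.
  set z := (k' - k) *: R3 + R2 in g4 *.
  apply/esym/eqP; rewrite -subr_eq0; apply/eqP.
  apply: (resolvent_injective SS k'0).
  have := generator_graph_linear (r := -1) SS g1 g4.
  have -> : -1 *: R1 + z = z - R1 by rewrite scaleN1r addrC.
  suff -> : -1 *: (k *: R1 - u) + ((k' - k) *: (k' *: R3 - R1) + (k' *: R2 - u)) = k' *: (z - R1) by [].
  have -> : (k' - k) *: (k' *: R3 - R1) + (k' *: R2 - u) = k' *: (z - R1) + (k *: R1 - u).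
    rewrite /z !scalerBr scalerDr !scalerA [k' * _]mulrC (scalerBl k' k R1) opprB -!addrA.
    by congr (_ + _); rewrite addrCA [k *: R1 + (_ + _)]addrCA addrCA.
  by rewrite scaleN1r addrC addrK.
- by rewrite -XiE.
Qed.

End ResolventFunctional.
End SubstochasticSemigroups.

(** * Null spaces *)

Section NullSpace.
Context {R : realType} {h : completeNormedModType R[i]}.
Variable form : {dot h for Num.conj}.
Hypothesis form_hilbert : hilbert_form form.
Implicit Types beta rho : h -> h.

(** Rank one operators of the cone detect the kernel, which turns statements on zeros of [Xi] into
    statements on null spaces. If the trace vanishes, evaluating at [x] gives
    [form x x *: beta x = 0]. *)
Lemma null_space_rank_one beta x : psd_op form beta ->
  beta x = 0 <-> complex.Re (trace form (beta \o (fun y => form y x *: x))) = 0.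
Proof.
move=> bp; have [sb _ _] := bp.
rewrite (trace_psd_mul_eq0 form_hilbert bp (rank_one_Tspos form_hilbert x)).
split=> [bx y|bx]; first by rewrite (adjZ form_hilbert sb) bx scaler0.
have [->|x0] := eqVneq x 0; first exact: (adj0 form_hilbert sb).
have := bx x; rewrite (adjZ form_hilbert sb) => /eqP; rewrite scaler_eq0.
move=> /orP[|/eqP //]; rewrite selfadjoint_real //.
move=> /eqP/complexI/(ip_eq0 form_hilbert) x00.
by rewrite x00 eqxx in x0.
Qed.

(** The left side says that the range of [rho] lies in the kernel of [beta], i.e. [P \o rho = rho];
    the other equation is its adjoint. *)
Lemma annihilates_iff_proj beta rho : psd_op form beta -> selfadjoint form rho ->
  let P := orth_proj form (null_space beta) in
  (forall x, beta (rho x) = 0) <-> rho = P \o rho /\ rho = rho \o P.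
Proof.
move=> [sb _ [M bM]] srho P.
have ND := kernelD form_hilbert sb; have NZ := kernelZ form_hilbert sb.
have N0 : null_space beta 0 by exact: (adj0 form_hilbert sb).
have Ncl := kernel_closed form_hilbert sb bM.
have Ps : selfadjoint form P := orth_proj_selfadjoint form_hilbert N0 ND NZ Ncl.
split=> [br|[rP _] x].
  have Pr x : P (rho x) = rho x by apply: orth_proj_id => //; exact: br.
  split; first by apply/funext => x /=; rewrite Pr.
  apply/funext => x; apply: (form_ext form_hilbert) => z /=.
  by rewrite srho [RHS]srho Ps Pr.
rewrite rP /=; have [] := orth_projP form_hilbert N0 ND NZ Ncl (rho x).
by [].
Qed.

End NullSpace.

Theorem theorem3p22 (R : realType) (h : completeNormedModType R[i])
  (form : {dot h for Num.conj})
  (h_hilbert : hilbert_form form)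
  (h_separable : separable h)
  (U : R -> (h -> h) -> (h -> h))
  (U_substochastic : substochastic form U)
  (B : (h -> h) -> (h -> h))
  (B_perturbation : admissible_perturbation form U B)
  (V : R -> (h -> h) -> (h -> h))
  (V_minimal : minimal_semigroup form U B V)
  (abar : (h -> h) -> R)
  (abarP : is_abar form U B V abar)
  (beta : R -> (h -> h))
  (betaP : forall lambda : R, 0 < lambda ->
     represents_Xi form V abar lambda (beta lambda)) :
  (forall lambda mu : R, 0 < lambda -> 0 < mu ->
     null_space (beta lambda) = null_space (beta mu)) /\
  (forall lambda : R, 0 < lambda ->
     let P : h -> h := orth_proj form (null_space (beta lambda)) in
     let Q : h -> h := fun x => x - P x in
     Hset form V abar =
       [set rho | [/\ Tspos form rho, rho = P \o rho & rho = rho \o P]] /\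
     Hset form V abar =
       [set rho : h -> h |
         [/\ Tspos form rho, Q \o rho = (fun=> 0) & rho \o Q = (fun=> 0)]]).
Proof.
have [V_sub _ _] := V_minimal; have [abar_lin _] := abarP.
have beta_psd l : 0 < l -> psd_op form (beta l).
  by move=> /betaP[bb _ b0 _]; exact/(psd_opP h_hilbert).
have XiE l rho : 0 < l -> Tspos form rho ->
    Xi form V abar l rho = complex.Re (trace form (beta l \o rho)).
  by move=> l0 tr; have [_ _ _ bX] := betaP l l0; rewrite -bX.
have indep l m rho : 0 < l -> 0 < m -> Tspos form rho ->
    Xi form V abar m rho = 0 -> Xi form V abar l rho = 0.
  exact: (Xi_eq0_indep h_hilbert V_sub abar_lin betaP).
split.
  have sub l m : 0 < l -> 0 < m -> null_space (beta l) `<=` null_space (beta m).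
    move=> l0 m0 x; rewrite /null_space /=.
    move=> /(null_space_rank_one h_hilbert x (beta_psd l l0)) bx.
    apply/(null_space_rank_one h_hilbert x (beta_psd m m0)).
    have tx := rank_one_Tspos h_hilbert x.
    by rewrite -XiE //; apply: (indep m l) => //; rewrite XiE.
  by move=> l m l0 m0; apply/seteqP; split; exact: sub.
move=> l l0 P Q.
have HE rho : Hset form V abar rho <->
    Tspos form rho /\ (rho = P \o rho /\ rho = rho \o P).
  split=> [[tr Xr]|[tr rP]]; split => //.
    apply/(annihilates_iff_proj h_hilbert (beta_psd l l0) tr.1.1).
    apply/(trace_psd_mul_eq0 h_hilbert (beta_psd l l0) tr).
    by rewrite -XiE // Xr.
  (* The projection built from [beta l] only yields the zero of [Xi] at [l]; independence carries it
     to every [m]. *)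
  move=> m m0; apply: (indep m l) => //; rewrite XiE //.
  apply/(trace_psd_mul_eq0 h_hilbert (beta_psd l l0) tr).
  exact/(annihilates_iff_proj h_hilbert (beta_psd l l0) tr.1.1).
split; apply/seteqP; split => rho.
- by move=> /HE[tr [rP Pr]]; split.
- by move=> [tr rP Pr]; apply/HE.
- move=> /HE[tr [rP Pr]]; split => //; apply/funext => x.
    by rewrite /Q /= [X in X - _](congr1 (@^~ x) rP) subrr.
  rewrite /Q /= (adjB h_hilbert tr.1.1) [X in X - _](congr1 (@^~ x) Pr) /=.
  by rewrite subrr.
- move=> [tr Qr rQ]; apply/HE; split => //; split; apply/funext => x.
    by have := congr1 (@^~ x) Qr; rewrite /Q /= => /eqP; rewrite subr_eq0 => /eqP.
  have := congr1 (@^~ x) rQ; rewrite /Q /= (adjB h_hilbert tr.1.1).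
  by move=> /eqP; rewrite subr_eq0 => /eqP.
Qed.
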